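(* Let $(C,F,D,G)$ be the data of a hybrid inclusion on $\mathbb R^n$ satisfying the Hybrid Basic Conditions, and let $(\phi,\{h_k\}_{k=1}^\infty)$ be an asymptotic simulation of the hybrid inclusion. Then the $\omega$-limit set of $\phi$ is nonempty, compact, and weakly invariant and internally chain transitive for the hybrid inclusion.
   Context: $\mathbb B$ is the closed unit ball. A hybrid time domain is the union of a nondecreasing sequence of compact hybrid time domains, i.e. sets $\bigcup_{i=0}^{J-1}[t_i,t_{i+1}]\times\{i\}$ with $J\ge1$, $0=t_0\le\dots\le t_J$. A hybrid arc is a function $\phi:\mathrm{dom}\,\phi\to\mathbb R^n$ on a hybrid time domain such that $t\mapsto\phi(t,j)$ is absolutely continuous on $[t,t']$ whenever $(t,j),(t',j)\in\mathrm{dom}\,\phi$, $t<t'$; it is complete if its domain is unbounded. Hybrid inclusion: $x\in C,\ \dot x\in F(x)$; $x\in D,\ x^+\in G(x)$, with $C,D\subset\mathbb R^n$, $F,G:\mathbb R^n\rightrightarrows\mathbb R^n$. Hybrid Basic Conditions: $C,D$ closed; $F,G$ outer semicontinuous and locally bounded; $F(x)$ nonempty and convex for all $x\in C$; $G(x)$ nonempty for all $x\in D$. A solution is a hybrid arc $\phi$ with $\phi(0,0)\in C\cup D$ such that: whenever $[t,t']\times\{j\}\subset\mathrm{dom}\,\phi$ with $t<t'$, $\phi(r,j)\in C$ and $\dot\phi(r,j)\in F(\phi(r,j))$ for almost all $r\in[t,t']$; whenever $(t,j),(t,j+1)\in\mathrm{dom}\,\phi$, $\phi(t,j)\in D$ and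 $\phi(t,j+1)\in G(\phi(t,j))$. $\mathcal S_{\mathcal H}$ is the set of all solutions. A compact hybrid sequence domain is a set $\bigcup_{i=0}^{J-1}\{k_i,k_i+1,\dots,k_{i+1}\}\times\{i\}$ with $J\ge1$ and integers $0=k_0\le k_1\le\dots\le k_J$; a hybrid sequence domain is the union of a nondecreasing sequence of these. A hybrid sequence is a mapping $\phi:\mathrm{dom}\,\phi\to\mathbb R^n$ on a hybrid sequence domain. It is complete if its domain is unbounded, and complete in the $k$ (resp. $j$) direction if the set of first (resp. second) coordinates of its domain is unbounded. Put $\overline{\jmath}_k:=\inf\{j\in\mathbb Z_{\ge0}:(k+1,j)\in\mathrm{dom}\,\phi\}$ and $\overline k_j:=\inf\{k\in\mathbb Z_{\ge0}:(k,j+1)\in\mathrm{dom}\,\phi\}$ ($\inf\emptyset=\infty$). Step sizes $\{h_k\}_{k=1}^\infty$ are admissible if $h_k>0$ for all $k$, $h_k\to0$, and $\sum_k h_k=\infty$. Put $\tau_k:=\sum_{i=0}^{k-1}h_{i+1}$ for $k\in\mathbb Z_{\ge0}$ and $m(t):=\max\{k\in\mathbb Z_{\ge0}:\tau_k\le t\}$ for $t\ge0$. A hybrid sequence $\phi$ and admissible step sizes $\{h_k\}$ form an asymptotic simulation of the hybrid inclusion if $\phi$ is bounded and complete and: (1) if $\phi$ is complete in the $k$ direction then there exists a bounded sequence $\{f_k\}_{k=0}^\infty$ in $\mathbb R^n$ such that $\limsup_{k\to\infty}(\phi(k,\overline{\jmath}_k),f_k)\subset\mathrm{graph}(F)\cap(C\times\mathbb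 R^n)$ and, with $\widehat f_{k+1}:=\frac{\phi(k+1,\overline{\jmath}_k)-\phi(k,\overline{\jmath}_k)}{h_{k+1}}$ for $k\in\mathbb Z_{\ge0}$, for some $T>0$, $\lim_{k\to\infty}\sup_{k+1\le\ell\le m(\tau_k+T)}\left|\sum_{i=k}^{\ell-1}h_{i+1}(\widehat f_{i+1}-f_i)\right|=0$; (2) if $\phi$ is complete in the $j$ direction then $\limsup_{j\to\infty}(\phi(\overline k_j,j),\phi(\overline k_j,j+1))\subset\mathrm{graph}(G)\cap(D\times\mathbb R^n)$. Here $\limsup$ of a sequence of points is the set of its accumulation (cluster) points. The $\omega$-limit set of $\phi$ is $\{z:\exists (k_i,j_i)\in\mathrm{dom}\,\phi,\ k_i+j_i\to\infty,\ \phi(k_i,j_i)\to z\}$. A set $K$ is weakly invariant if for every $x\in K$ and $T>0$ there exists a complete $\xi\in\mathcal S_{\mathcal H}$ with range in $K$ such that $\xi(t,j)=x$ for some $(t,j)\in\mathrm{dom}\,\xi$ with $t+j\ge T$. $K$ is internally chain transitive if for every $x,y\in K$ and $\tau,\varepsilon>0$ there exist $k^*\ge1$, points $x=x_0,\dots,x_{k^*}=y$, solutions $\xi_0,\dots,\xi_{k^*-1}\in\mathcal S_{\mathcal H}$ and $(t_k,j_k)\in\mathrm{dom}\,\xi_k$ with $t_k+j_k\ge\tau$ such that $\xi_k(0,0)=x_k$, $x_{k+1}\in\xi_k(t_k,j_k)+\varepsilon\mathbb B$, and $\xi_k(t,j)\in K$ for all $(t,j)\in\mathrm{dom}\,\xi_k$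 with $t+j\le t_k+j_k$. *)

(* Defs.v *)
From HB Require Import structures.
From mathcomp Require Import all_boot all_order all_algebra.
From mathcomp Require Import all_classical all_reals all_analysis.

Set Implicit Arguments.
Unset Strict Implicit.
Unset Printing Implicit Defensive.

Import Order.TTheory GRing.Theory Num.Theory.
Import numFieldNormedType.Exports.

Local Open Scope classical_set_scope.
Local Open Scope ring_scope.

(* The library norm on 'rV[R]_n is the max norm; the topology, and hence
   closedness, compactness, boundedness and convergence, are the same for both. *)
Definition enorm (R : realType) (n : nat) (x : 'rV[R]_n) : R :=
  Num.sqrt (\sum_(i < n) x 0 i ^+ 2).

(* Only applied below to sets that do have a least (resp. greatest) element:
   the value 0 on other sets is never used. *)
Definition nat_min (A : set nat) : nat := xget 0%N (A `&` lbound A).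
Definition nat_max (A : set nat) : nat := xget 0%N (A `&` ubound A).

Definition nondecreasing_union (T : Type) (P : set (set T)) (E : set T) : Prop :=
  exists2 U : nat -> set T,
    (forall i, P (U i)) /\ (forall i, U i `<=` U i.+1) &
    E = \bigcup_i U i.

Section HybridTime.
Variables (R : realType) (n : nat).

Definition compact_hybrid_time_domain (E : set (R * nat)) : Prop :=
  exists (J : nat) (t : nat -> R),
    [/\ (1 <= J)%N, t 0%N = 0,
        forall i, (i < J)%N -> t i <= t i.+1 &
        E = \bigcup_(i in [set i | (i < J)%N]) (`[t i, t i.+1] `*` [set i])].

Definition hybrid_time_domain : set (R * nat) -> Prop :=
  nondecreasing_union compact_hybrid_time_domain.

Definition absolutely_continuous_on (f : R -> 'rV[R]_n) (a b : R) : Prop :=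
  forall e : R, 0 < e -> exists2 d : R, 0 < d &
    forall (N : nat) (s t : 'I_N -> R),
      (forall i, a <= s i /\ s i <= t i /\ t i <= b) ->
      trivIset setT (fun i => `]s i, t i[%classic) ->
      \sum_(i < N) (t i - s i) < d ->
      \sum_(i < N) enorm (f (t i) - f (s i)) < e.

(* The function is total; its values outside [arc_dom] are irrelevant. *)
Record hybrid_arc := HybridArc {
  arc_dom : set (R * nat);
  arc_val :> R * nat -> 'rV[R]_n;
  arc_domP : hybrid_time_domain arc_dom;
  arc_acP : forall (j : nat) (t t' : R),
    arc_dom (t, j) -> arc_dom (t', j) -> t < t' ->
    absolutely_continuous_on (fun s => arc_val (s, j)) t t' }.

(* Coordinates are nonnegative, so unboundedness is that of t + j. *)
Definition arc_complete (xi : hybrid_arc) : Prop :=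
  ~ has_ubound [set p.1 + p.2%:R | p in arc_dom xi].

End HybridTime.

Section HybridInclusion.
Variables (R : realType) (n : nat).

Record hybrid_inclusion := HybridInclusion {
  flow_set : set 'rV[R]_n;
  flow_map : 'rV[R]_n -> set 'rV[R]_n;
  jump_set : set 'rV[R]_n;
  jump_map : 'rV[R]_n -> set 'rV[R]_n }.

Definition graph (F : 'rV[R]_n -> set 'rV[R]_n) : set ('rV[R]_n * 'rV[R]_n) :=
  [set p | F p.1 p.2].

Definition outer_semicontinuous (F : 'rV[R]_n -> set 'rV[R]_n) : Prop :=
  forall (u v : nat -> 'rV[R]_n) (x y : 'rV[R]_n),
    u @ \oo --> x -> v @ \oo --> y -> (forall i, F (u i) (v i)) -> F x y.

Definition locally_bounded (F : 'rV[R]_n -> set 'rV[R]_n) : Prop :=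
  forall x : 'rV[R]_n, exists2 U, nbhs x U & bounded_set (\bigcup_(y in U) F y).

Record hybrid_basic_conditions (H : hybrid_inclusion) : Prop := {
  hbc_flow_closed : closed (flow_set H);
  hbc_jump_closed : closed (jump_set H);
  hbc_flow_osc : outer_semicontinuous (flow_map H);
  hbc_jump_osc : outer_semicontinuous (jump_map H);
  hbc_flow_lb : locally_bounded (flow_map H);
  hbc_jump_lb : locally_bounded (jump_map H);
  hbc_flow_nonempty : forall x, flow_set H x -> flow_map H x !=set0;
  hbc_flow_convex : forall x, flow_set H x ->
    convex_set (flow_map H x : set (convex_lmodType 'rV[R]_n));
  hbc_jump_nonempty : forall x, jump_set H x -> jump_map H x !=set0 }.

(* At interior points of [t, t'] the derivative only depends on the values of
   xi on its domain, and the two endpoints are Lebesgue negligible. *)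
Record solution (H : hybrid_inclusion) (xi : hybrid_arc R n) : Prop := {
  sol_init : (flow_set H `|` jump_set H) (xi (0, 0%N));
  sol_flow : forall (j : nat) (t t' : R), t < t' ->
    `[t, t'] `*` [set j] `<=` arc_dom xi ->
    {ae lebesgue_measure, forall r : R, `[t, t']%classic r ->
      [/\ flow_set H (xi (r, j)),
          derivable (fun s : R => xi (s, j)) r 1 &
          flow_map H (xi (r, j)) (derive1 (fun s : R => xi (s, j)) r)]};
  sol_jump : forall (t : R) (j : nat),
    arc_dom xi (t, j) -> arc_dom xi (t, j.+1) ->
    jump_set H (xi (t, j)) /\ jump_map H (xi (t, j)) (xi (t, j.+1)) }.

Definition weakly_invariant (H : hybrid_inclusion) (K : set 'rV[R]_n) : Prop :=
  forall (x : 'rV[R]_n) (T : R), K x -> 0 < T ->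
    exists xi : hybrid_arc R n,
      [/\ solution H xi, arc_complete xi, xi @` arc_dom xi `<=` K &
          exists t j, [/\ arc_dom xi (t, j), xi (t, j) = x & T <= t + j%:R]].

Definition internally_chain_transitive (H : hybrid_inclusion)
    (K : set 'rV[R]_n) : Prop :=
  forall (x y : 'rV[R]_n) (tau e : R), K x -> K y -> 0 < tau -> 0 < e ->
    exists (N : nat) (xs : nat -> 'rV[R]_n) (xi : nat -> hybrid_arc R n)
           (t : nat -> R) (j : nat -> nat),
      [/\ (1 <= N)%N, xs 0%N = x, xs N = y &
        forall k, (k < N)%N ->
          [/\ solution H (xi k),
              arc_dom (xi k) (t k, j k) /\ tau <= t k + (j k)%:R,
              xi k (0, 0%N) = xs k,
              enorm (xs k.+1 - xi k (t k, j k)) <= e &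
              forall s i, arc_dom (xi k) (s, i) ->
                s + i%:R <= t k + (j k)%:R -> K (xi k (s, i))]].

End HybridInclusion.

Section HybridSequence.
Variables (R : realType) (n : nat).

Definition compact_hybrid_sequence_domain (E : set (nat * nat)) : Prop :=
  exists (J : nat) (k : nat -> nat),
    [/\ (1 <= J)%N, k 0%N = 0%N,
        forall i, (i < J)%N -> (k i <= k i.+1)%N &
        E = \bigcup_(i in [set i | (i < J)%N])
              ([set l | (k i <= l <= k i.+1)%N] `*` [set i])].

Definition hybrid_sequence_domain : set (nat * nat) -> Prop :=
  nondecreasing_union compact_hybrid_sequence_domain.

(* The function is total; its values outside [seq_dom] are irrelevant. *)
Record hybrid_sequence := HybridSequence {
  seq_dom : set (nat * nat);
  seq_val :> nat * nat -> 'rV[R]_n;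
  seq_domP : hybrid_sequence_domain seq_dom }.

Implicit Types (phi : hybrid_sequence) (h : nat -> R).

Definition seq_complete phi : Prop :=
  ~ has_ubound [set (p.1 + p.2)%N | p in seq_dom phi].
Definition seq_complete_k phi : Prop := ~ has_ubound (fst @` seq_dom phi).
Definition seq_complete_j phi : Prop := ~ has_ubound (snd @` seq_dom phi).

(* If phi is complete in the k (resp. j) direction, the set in [jbar]
   (resp. [kbar]) is nonempty, so the infimum is a minimum. *)
Definition jbar phi (k : nat) : nat := nat_min [set j | seq_dom phi (k.+1, j)].
Definition kbar phi (j : nat) : nat := nat_min [set k | seq_dom phi (k, j.+1)].

(* Step sizes are indexed from 1: the value [h 0] is never used. *)
Definition tau h (k : nat) : R := \sum_(0 <= i < k) h i.+1.

Definition admissible h : Prop :=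
  [/\ forall k, (1 <= k)%N -> 0 < h k,
      h @ \oo --> (0 : R) &
      tau h @ \oo --> +oo].

(* For admissible h and t >= 0, the set contains 0 and is finite. *)
Definition steps_until h (t : R) : nat := nat_max [set k | tau h k <= t].

(* [discrete_velocity phi h k] is the difference quotient of index k + 1. *)
Definition discrete_velocity phi h (k : nat) : 'rV[R]_n :=
  (h k.+1)^-1 *: (phi (k.+1, jbar phi k) - phi (k, jbar phi k)).

(* [sup] is the supremum of a finite set, which is nonempty for k large. *)
Definition averaged_error phi h (f : nat -> 'rV[R]_n) (T : R) (k : nat) : R :=
  sup [set enorm (\sum_(k <= i < l) h i.+1 *: (discrete_velocity phi h i - f i))
        | l in [set l | (k.+1 <= l <= steps_until h (tau h k + T))%N]].

Record asymptotic_simulation (H : hybrid_inclusion R n) phi h : Prop := {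
  sim_steps : admissible h;
  sim_bounded : bounded_set (phi @` seq_dom phi);
  sim_complete : seq_complete phi;
  sim_flow : seq_complete_k phi ->
    exists f : nat -> 'rV[R]_n,
      [/\ bounded_set (range f),
          cluster ((fun k => (phi (k, jbar phi k), f k)) @ \oo)
            `<=` graph (flow_map H) `&` (flow_set H `*` setT) &
          exists2 T : R, 0 < T & averaged_error phi h f T @ \oo --> (0 : R)];
  sim_jump : seq_complete_j phi ->
    cluster ((fun j => (phi (kbar phi j, j), phi (kbar phi j, j.+1))) @ \oo)
      `<=` graph (jump_map H) `&` (jump_set H `*` setT) }.

Definition omega_limit phi : set 'rV[R]_n :=
  [set z | exists u : nat -> nat * nat,
    [/\ forall i, seq_dom phi (u i),
        (fun i => ((u i).1 + (u i).2)%N) @ \oo --> \oo &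
        (fun i => phi (u i)) @ \oo --> z]].

End HybridSequence.

(* Main.v *)
From HB Require Import structures.
Require Import Defs.
From mathcomp Require Import all_boot all_order all_algebra.
From mathcomp Require Import all_classical all_reals all_analysis.
From mathcomp Require Import zify ring lra.

Set Implicit Arguments.
Unset Strict Implicit.
Unset Printing Implicit Defensive.

Import Order.TTheory GRing.Theory Num.Theory.
Import numFieldNormedType.Exports.

Local Open Scope classical_set_scope.
Local Open Scope ring_scope.

(** The hybrid sequence can be read as one long run, and solutions of the
    inclusion arise as limits of later and later pieces of it.

    The points of an unbounded hybrid sequence domain are totally ordered, one
    for each value of [k + j], so the simulation is an ordinary sequence of
    points, with a time [tau h k] and a jump count [j] attached
    ([sequence_domain_enum], [simulation_run]).  Look at the run from the index
    [M i] on, with [M i] tending to infinity.  Everything that has to converge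
    (values, elapsed times, numbers of jumps) is bounded, hence converges along
    a fixed ultrafilter on the indices [i]; this replaces both the diagonal
    extraction and the Arzela-Ascoli theorem.  A point [(s, k)] belongs to the
    domain of the limit arc when the run passes, seen from [M i], near time [s]
    after exactly [k] jumps ([track]).  That set is a complete hybrid time domain
    ([limit_dom_htd]).  Between jumps the run moves, up to vanishing errors, with
    the bounded velocities [g], so the limit arc is well defined and Lipschitz on
    every level ([track_close], [limit_lipschitz]).

    The limit arc is a solution ([limit_arc_solution]).  Jumps pass to the limit
    directly.  For flows, Lipschitz functions are differentiable almost everywhere
    ([rv_lipschitz_ae_derivable]), and where the derivative exists it is found
    without weak convergence: a difference quotient is the limit of averages of
    velocities taken at points close to [p], by compactness these velocities are
    close to [flow_map H p] ([run_vel_near]), and this set is convex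
    ([limit_quotient]) and closed.

    The omega-limit set contains the limit arcs ([limit_shadow]).  For weak
    invariance, take [M i] a hybrid time [T] before indices at which the run is
    near the prescribed point.  For chain transitivity, pieces of the run with
    bounded length starting late enough are uniformly close to limit arcs
    ([shadowing]); cutting the run between a passage near [x] and a later passage
    near [y] into such pieces gives the chain ([chain_to]), whose first arc must
    start exactly at [x] ([shadowing_from]). *)


(** * Maximum norm and Euclidean norm *)

Section Enorm.
Variables (R : realType) (n : nat).
Implicit Types v : 'rV[R]_n.

Lemma coord_le_norm v i : `|v 0 i| <= `|v|.
Proof.
rewrite [leRHS]/Num.Def.normr/= mx_normrE.
exact: (le_bigmax _ (fun ij => `|v ij.1 ij.2|) (0, i)).
Qed.

Lemma norm_le_enorm v : `|v| <= enorm v.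
Proof.
rewrite [leLHS]/Num.Def.normr/= mx_normrE.
apply: bigmax_le => [|[i j] _]; first exact: sqrtr_ge0.
rewrite /= (ord1 i) -sqrtr_sqr ler_wsqrtr// (bigD1 j)//= lerDl.
by apply: sumr_ge0 => k _; exact: sqr_ge0.
Qed.

Lemma enorm_le_norm v : enorm v <= n.+1%:R * `|v|.
Proof.
rewrite /enorm -[leRHS]ger0_norm ?mulr_ge0// -sqrtr_sqr ler_wsqrtr//.
apply: (@le_trans _ _ (\sum_(i < n) `|v| ^+ 2)).
  apply: ler_sum => i _; rewrite -real_normK ?num_real//.
  by rewrite ler_sqr ?nnegrE// coord_le_norm.
rewrite sumr_const card_ord exprMn -[_ ^+ 2 *+ n]mulr_natl ler_wpM2r ?sqr_ge0//.
rewrite -natrX ler_nat; apply: (@leq_trans n.+1) => //.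
by rewrite -mulnn leq_pmulr.
Qed.

End Enorm.

(** * Almost everywhere differentiability of Lipschitz functions *)

Section LipschitzDerivable.
Context {R : realType}.
Notation mu := (@lebesgue_measure R).

Lemma nonexpansive_continuous (f : R -> R) :
  (forall x y, x <= y -> 0 <= f y - f x <= y - x) -> continuous f.
Proof.
move=> fP x; apply/cvgrPdist_le => /= e e0; near=> y.
apply: (@le_trans _ _ `|x - y|); last first.
  by near: y; exact: cvgr_dist_le.
have [xy|/ltW yx] := leP x y.
- have /andP[h1 h2] := fP _ _ xy.
  by rewrite distrC [leRHS]distrC !ger0_norm// subr_ge0.
- have /andP[h1 h2] := fP _ _ yx.
  by rewrite !ger0_norm// subr_ge0.
Unshelve. all: by end_near. Qed.

Lemma stieltjes_itvoc (f : cumulative R R) (a b : R) : a <= b ->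
  lebesgue_stieltjes_measure f `]a, b]%classic = (f b - f a)%:E.
Proof.
move=> ab.
rewrite /lebesgue_stieltjes_measure /measure_extension/=.
rewrite measurable_mu_extE//=; last exact: is_ocitv.
by rewrite wlength_itv_bnd.
Qed.

(** The Stieltjes measures of [f] and [g] add up to that of the identity, which is
    Lebesgue measure. *)
Lemma stieltjes_le_lebesgue (f g : cumulative R R) :
  (forall x, f x + g x = x) -> forall A, measurable A ->
  (lebesgue_stieltjes_measure f A <= mu A)%E.
Proof.
move=> fg A mA.
pose nu : measure _ _ := measure_add
  (lebesgue_stieltjes_measure f) (lebesgue_stieltjes_measure g).
have nuE X : nu X =
    (lebesgue_stieltjes_measure f X + lebesgue_stieltjes_measure g X)%E.
  exact: measure_addE.
rewrite (@lebesgue_measure_unique _ nu _ A mA) ?nuE ?leeDl//.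
move=> X /ocitvP[->|[[x y]/= xy ->]]; first by rewrite !measure0.
rewrite nuE !stieltjes_itvoc ?ltW//.
rewrite lebesgue_measure_itv/= lte_fin xy -EFinD -!EFinD; congr EFin.
by rewrite -{1}(fg x) -{1}(fg y); ring.
Qed.

(** On a bounded interval the Stieltjes measure of [f] is finite and dominated by
    Lebesgue measure, so it has a Radon-Nikodym density; up to a constant, [f] is the
    primitive of this density, and Lebesgue's differentiation theorem applies. *)
Lemma nonexpansive_ae_derivable (f : R -> R) (a b : R) :
  (forall x y, x <= y -> 0 <= f y - f x <= y - x) ->
  {ae mu, forall x, a < x < b -> derivable f x 1}.
Proof.
move=> fP.
have [ab|ba] := ltP a b; last first.
  by apply: aeW => x /andP[h1 h2]; have := lt_trans h1 h2; rewrite ltNge ba.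
have fc := nonexpansive_continuous fP.
have fnd : nondecreasing f by move=> x y xy; have /andP[+ _] := fP _ _ xy; lra.
pose g x := x - f x.
have gP x y : x <= y -> 0 <= g y - g x <= y - x.
  by move=> xy; have := fP _ _ xy; rewrite /g; lra.
have gc := nonexpansive_continuous gP.
have gnd : nondecreasing g by move=> x y xy; have /andP[+ _] := gP _ _ xy; lra.
pose fM := isCumulative.Build R _ R f fnd (right_continuousW fc).
pose gM := isCumulative.Build R _ R g gnd (right_continuousW gc).
pose f' : cumulative R R := HB.pack f fM.
pose g' : cumulative R R := HB.pack g gM.
have mI : measurable (`]a, b]%classic : set (measurableTypeR R)).
  exact: measurable_itv.
have fin : (lebesgue_stieltjes_measure f' `]a, b]%classic < +oo)%E.
  by rewrite stieltjes_itvoc ?ltry// ltW.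
pose nu : {finite_measure set _ -> \bar R} := mfrestr mI fin.
have numu : nu `<< mu.
  move=> N N0 A mA AN; apply/eqP; rewrite eq_le measure_ge0 andbT.
  rewrite -(N0 A mA AN).
  apply: (@le_trans _ _ (lebesgue_stieltjes_measure f' A)).
    by apply: le_measure; rewrite ?inE//; exact: measurableI.
  by apply: (stieltjes_le_lebesgue (g := g')) => // x; rewrite /= /g; lra.
pose d := Radon_Nikodym_SigmaFinite.f nu mu.
have dfin x : d x \is a fin_num by exact: Radon_Nikodym_SigmaFinite.f_fin_num.
have dE : d = EFin \o (fine \o d) by apply/funext => x /=; rewrite fineK.
have dint : mu.-integrable setT (EFin \o (fine \o d)).
  by rewrite -dE; exact: Radon_Nikodym_SigmaFinite.f_integrable.
have intd y : mu.-integrable `]-oo, y] (EFin \o (fine \o d)).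
  exact: integrableS dint.
have locd : locally_integrable [set: R] (fine \o d).
  by apply: open_integrable_locally => //; exact: openT.
have := FTC1Ny intd locd.
apply: filterS; first exact: (ae_filter_ringOfSetsType mu).
move=> x [Fx _] /andP[ax xb].
pose F y := (\int[mu]_(t in `]-oo, y]) (fine \o d) t)%R.
have FE y : a < y < b -> F y = f y - f a.
  move=> /andP[ay yb].
  rewrite /F /Rintegral; under eq_integral do rewrite /= fineK//.
  rewrite -(Radon_Nikodym_SigmaFinite.f_integral numu)//.
  have -> : nu `]-oo, y]%classic = lebesgue_stieltjes_measure f' `]a, y]%classic.
    congr (lebesgue_stieltjes_measure f' _).
    apply/seteqP; split => z /=; rewrite !in_itv/=; first by move=> [-> /andP[->]].
    by move=> /andP[az zy]; rewrite zy az (le_trans zy (ltW yb)).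
  by rewrite stieltjes_itvoc//= ltW.
have {}Fx : derivable F x 1 := Fx.
clearbody F.
have dF : derivable (fun y => F y + f a) x 1.
  exact: (@derivableD _ _ _ F (cst (f a)) _ _ Fx (derivable_cst _ _ _)).
refine (@near_eq_derivable _ _ _ (fun y => F y + f a) f x 1 _ dF); near=> y.
rewrite FE ?subrK//; apply/andP; split; near: y.
  exact: lt_nbhsr.
exact: lt_nbhsl.
Unshelve. all: by end_near. Qed.

(** Both [(u / L + id) / 2] and its difference with the identity are nondecreasing,
    which reduces the claim to the nonexpansive case. *)
Lemma lipschitz_ae_derivable (u : R -> R) (a b L : R) : 0 < L ->
  (forall x y, a <= x -> x <= y -> y <= b -> `|u y - u x| <= L * (y - x)) ->
  {ae mu, forall x, a < x < b -> derivable u x 1}.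
Proof.
move=> L0 uL.
have [ab|ba] := ltP a b; last first.
  by apply: aeW => x /andP[h1 h2]; have := lt_trans h1 h2; rewrite ltNge ba.
(* Clamping to the segment makes the estimate global. *)
pose c x := Num.max a (Num.min x b).
pose f x := (L^-1 * u (c x) + x) / 2.
have fP x y : x <= y -> 0 <= f y - f x <= y - x.
  move=> xy.
  have ac z : a <= c z by rewrite le_max lexx.
  have cb z : c z <= b by rewrite ge_max (ltW ab) ge_min lexx orbT.
  have ccD : 0 <= c y - c x <= y - x.
    rewrite /c /Num.max /Num.min; do ![case: ifP]; lra.
  have /(uL _ _ (ac x))/(_ (cb y)) : c x <= c y by move/andP: ccD; lra.
  rewrite mulrC -ler_pdivrMr// -[X in _ / X](gtr0_norm L0) -normf_div ler_norml.
  rewrite /f [(_ - _) / L]mulrC mulrBr.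
  by move: ccD => /andP[? ?] /andP[? ?]; apply/andP; split; lra.
have := nonexpansive_ae_derivable a b fP.
apply: filterS; first exact: (ae_filter_ringOfSetsType mu).
move=> x + axb => /(_ axb) fx; move: axb => /andP[ax xb].
have dF : derivable (fun y => (2 * L) *: f y + (- L) *: y) x 1.
  exact: (@derivableD _ _ _ (2 * L \*: f) (- L \*: id) _ _
    (derivableZ fx) (derivableZ (@derivable_id _ _ _ _))).
refine (@near_eq_derivable _ _ _ _ u x 1 _ dF); near=> y.
have ay : a < y by near: y; exact: lt_nbhsr.
have yb : y < b by near: y; exact: lt_nbhsl.
have -> : u y = u (c y).
  by rewrite /c (min_idPl (ltW yb)) (max_idPr (ltW ay)).
rewrite /f /= /GRing.scale/=; field.
by rewrite gt_eqF.
Unshelve. all: by end_near. Qed.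

Lemma rv_lipschitz_ae_derivable (n : nat) (u : R -> 'rV[R]_n) (a b L : R) :
  0 < L ->
  (forall x y, a <= x -> x <= y -> y <= b -> `|u y - u x| <= L * (y - x)) ->
  {ae mu, forall x, a < x < b -> derivable u x 1}.
Proof.
move=> L0 uL.
have H : forall i, {ae mu, forall x, a < x < b -> derivable (fun s => u s 0 i) x 1}.
  move=> i; apply: (lipschitz_ae_derivable L0) => x y ax xy yb.
  apply: le_trans (uL x y ax xy yb).
  have -> : u y 0 i - u x 0 i = (u y - u x) 0 i by rewrite !mxE.
  exact: coord_le_norm.
have ae_filter := @ae_filter_ringOfSetsType _ _ _ mu.
have := filter_forall ae_filter H.
apply: filterS => x /= Hx axb; apply/derivable_mxP => i j.
rewrite (ord1 i); exact: Hx.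
Qed.

End LipschitzDerivable.

(** * Limits along ultrafilters *)

(** Limits along one ultrafilter on the indices exist simultaneously for all
    bounded sequences, so that no subsequence ever has to be chosen. *)
Section Ultrafilter.
Context (F : set_system nat) (FF : UltraFilter F).

Lemma ultra_cvg (T : topologicalType) (K : set T) (f : nat -> T) :
  compact K -> (\forall i \near F, K (f i)) -> exists2 p, K p & f @ F --> p.
Proof.
move=> cK FK; have [p [Kp clp]] := cK (f @ F) _ FK.
exists p => // A Ap; have [//|nA] := in_ultra_setVsetC (f @^-1` A) FF.
by have [q [nAq Aq]] := clp (~` A) A nA Ap.
Qed.

Lemma ultra_cvg_real (R : realType) (f : nat -> R) (a b : R) :
  (\forall i \near F, a <= f i <= b) -> exists l : R, f @ F --> l.
Proof.
move=> fab; have [|p _ fp] := @ultra_cvg R `[a, b] f (@segment_compact _ a b).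
  by apply: filterS fab => i; rewrite /= in_itv/=.
by exists p.
Qed.

Lemma ultra_cvg_rV (R : realType) n (f : nat -> 'rV[R]_n) (K : R) :
  (forall i, `|f i| <= K) -> exists l : 'rV[R]_n, f @ F --> l.
Proof.
move=> fK; pose A : set 'rV[R]_n := [set y | `|y| <= K].
have cA : compact A.
  apply: bounded_closed_compact; last first.
    have -> : A = closed_ball_ (@Num.norm _ 'rV[R]_n) 0 K.
      by apply/seteqP; split=> y; rewrite /A /closed_ball_/= sub0r normrN.
    exact: closed_closed_ball_.
  exists K; split; first exact: num_real.
  by move=> x Kx y; rewrite /A/= => /le_trans; apply; exact: ltW.
have [|p _ fp] := ultra_cvg cA (f := f).
  by apply: nearW => i; rewrite /A/=.
by exists p.
Qed.

Lemma ultra_cst (f : nat -> nat) (K : nat) :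
  (\forall i \near F, (f i <= K)%N) -> exists k, \forall i \near F, f i = k.
Proof.
elim: K => [|K IH] fK.
  by exists 0%N; apply: filterS fK => i; rewrite leqn0 => /eqP.
have [fE|fE] := in_ultra_setVsetC [set i | f i = K.+1] FF; first by exists K.+1.
apply: IH; near=> i; rewrite -ltnS ltn_neqAle; apply/andP; split.
  by apply/eqP; near: i.
by near: i.
Unshelve. all: by end_near. Qed.

End Ultrafilter.

(** * Weighted sums near a convex set *)

Section WeightedSum.
Context (R : realType) (n : nat).
Implicit Types (A : set 'rV[R]_n) (t : nat -> R) (g : nat -> 'rV[R]_n).

(** The average of points of [A] with weights [t i.+1 - t i] is again in [A];
    replacing each of them by [g i] moves the weighted sum by at most [e] times the
    total weight.  The sum is not divided by the total weight, which may vanish. *)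
Lemma wsum_near_convex A t g (e : R) (m m' : nat) :
  A !=set0 ->
  convex_set (A : set (convex_lmodType 'rV[R]_n)) ->
  {homo t : i j / (i <= j)%N >-> i <= j} -> (m <= m')%N ->
  (forall i, (m <= i < m')%N -> exists2 a, A a & `|g i - a| <= e) ->
  exists2 a, A a &
    `|\sum_(m <= i < m') (t i.+1 - t i) *: g i - (t m' - t m) *: a|
       <= e * (t m' - t m).
Proof.
move=> [a0 Aa0] cA tnd; elim: m' => [|m' IH] mm' gA.
  exists a0 => //; move: mm'; rewrite leqn0 => /eqP ->.
  by rewrite big_geq// subrr scale0r mulr0 subrr normr0.
move: mm'; rewrite leq_eqVlt => /predU1P[<-|].
  by exists a0 => //; rewrite big_geq// subrr scale0r mulr0 subrr normr0.
rewrite ltnS => mm'.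
have [|a Aa Ha] := IH mm'.
  by move=> i /andP[mi im']; apply: gA; rewrite mi ltnW.
have [|b Ab Hb] := gA m'; first by rewrite mm' /=.
rewrite big_nat_recr//=.
have d10 : 0 <= t m' - t m by rewrite subr_ge0 tnd.
have d20 : 0 <= t m'.+1 - t m' by rewrite subr_ge0 tnd.
have -> : t m'.+1 - t m = (t m' - t m) + (t m'.+1 - t m') by ring.
move: (t m' - t m) (t m'.+1 - t m') d10 d20 Ha => d1 d2 d10 d20 Ha.
have [q Aq Eq] : exists2 q, A q & (d1 + d2) *: q = d1 *: a + d2 *: b.
  have [d0|d0] := eqVneq (d1 + d2) 0.
    exists a => //; have [-> ->] : d1 = 0 /\ d2 = 0 by split; lra.
    by rewrite addr0 !scale0r addr0.
  have d12 : 0 < d1 + d2 by rewrite lt_neqAle eq_sym d0 addr_ge0.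
  have p0 : 0 <= d1 / (d1 + d2) by rewrite divr_ge0// ltW.
  have p1 : d1 / (d1 + d2) <= 1 by rewrite ler_pdivrMr//; lra.
  exists ((d1 / (d1 + d2)) *: a + (1 - d1 / (d1 + d2)) *: b).
    have := cA a b (Itv01 p0 p1); rewrite !inE; exact.
  by rewrite scalerDr !scalerA; congr (_ *: _ + _ *: _); field.
exists q => //; rewrite Eq.
rewrite (_ : _ - _ = (\sum_(m <= i < m') (t i.+1 - t i) *: g i - d1 *: a)
  + d2 *: (g m' - b)); last by rewrite scalerBr opprD addrACA.
rewrite mulrDr; apply: le_trans (ler_normD _ _) _; apply: lerD => //.
by rewrite normrZ (ger0_norm d20) mulrC ler_wpM2r.
Qed.

(** This is the case [A = [set 0]] of the previous lemma. *)
Lemma wsum_le t g (B : R) (m m' : nat) :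
  {homo t : i j / (i <= j)%N >-> i <= j} -> (m <= m')%N ->
  (forall i, `|g i| <= B) ->
  `|\sum_(m <= i < m') (t i.+1 - t i) *: g i| <= B * (t m' - t m).
Proof.
move=> tnd mm' gB.
have [||i _|a ->] := @wsum_near_convex [set 0] t g B m m' _ _ tnd mm'.
- by exists 0.
- move=> a b l; rewrite !inE => -> ->; rewrite /conv/= .
  by apply/esym; rewrite !scaler0 addr0.
- by exists 0 => //; rewrite subr0.
by rewrite scaler0 subr0.
Qed.

End WeightedSum.

(** * Runs and their tracks *)

(** An asymptotic simulation with its domain flattened: [x m] is the [m]-th point,
    [t m] its ordinary time, [c m] the number of jumps before it and [g m] the
    velocity that approximates a flow at it.  [run_drift] is the condition on the
    averaged errors; [run_flow] and [run_jump] are the conditions on cluster points,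
    stated for filters so that they apply to limits along ultrafilters. *)
Record asymptotic_run (R : realType) (n : nat) (H : hybrid_inclusion R n)
    (x : nat -> 'rV[R]_n) (t : nat -> R) (c : nat -> nat)
    (g : nat -> 'rV[R]_n) (X B w : R) : Prop := {
  run_step : forall m, (c m.+1 = c m /\ t m <= t m.+1) \/
                       (c m.+1 = (c m).+1 /\ t m.+1 = t m);
  run_mesh : (fun m => t m.+1 - t m) @ \oo --> (0 : R);
  run_diverges : forall a, exists m, a <= t m + (c m)%:R;
  run_bounded : forall m, `|x m| <= X;
  run_vel_bounded : forall m, `|g m| <= B;
  run_window : 0 < w;
  run_drift : forall e, 0 < e -> \forall m0 \near \oo, forall m m',
    (m0 <= m <= m')%N -> c m = c m' -> t m' <= t m + w ->
    `|x m' - x m - \sum_(m <= i < m') (t i.+1 - t i) *: g i| <= e;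
  run_flow : forall (F : set_system nat) (p v : 'rV[R]_n),
    ProperFilter F -> F --> \oo -> (\forall m \near F, c m.+1 = c m) ->
    x @ F --> p -> g @ F --> v -> flow_set H p /\ flow_map H p v;
  run_jump : forall (F : set_system nat) (p q : 'rV[R]_n),
    ProperFilter F -> F --> \oo -> (\forall m \near F, c m.+1 = (c m).+1) ->
    x @ F --> p -> x m.+1 @[m --> F] --> q ->
    jump_set H p /\ jump_map H p q }.

Section Discrete.

(** The step of [f] that passes the level [a], by discrete continuity. *)
Lemma crossing (R : realType) (f : nat -> R) (a : R) (m1 m2 : nat) :
  (m1 <= m2)%N -> f m1 < a <= f m2 ->
  exists2 m, (m1 <= m < m2)%N & f m < a <= f m.+1.
Proof.
elim: m2 => [|m2 IH].
  by rewrite leqn0 => /eqP ->; lra.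
rewrite leq_eqVlt ltnS => /predU1P[->|m12]; first by lra.
move=> /andP[fa af]; have [fm2|fm2] := leP a (f m2).
  have [|m /andP[m1m mm2] h] := IH m12; first by rewrite fa.
  by exists m => //; rewrite m1m ltnW.
by exists m2; rewrite ?m12 ?leqnn ?fm2.
Qed.

Lemma near_choice (F : set_system nat) (FF : Filter F) (P : nat -> nat -> Prop) :
  (\forall i \near F, exists m, P i m) ->
  exists N : nat -> nat, \forall i \near F, P i (N i).
Proof.
move=> FP; exists (fun i => xget 0%N (P i)).
by apply: filterS FP => i [m Pm]; exact: (xgetI _ Pm).
Qed.

End Discrete.

Section Run.
Variables (R : realType) (n : nat) (H : hybrid_inclusion R n).
Variables (x : nat -> 'rV[R]_n) (t : nat -> R) (c : nat -> nat).
Variables (g : nat -> 'rV[R]_n) (X B w : R).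
Hypothesis run : asymptotic_run H x t c g X B w.

Lemma run_time_homo : {homo t : i j / (i <= j)%N >-> i <= j}.
Proof.
by apply: homo_leq => [//|i|i]; [exact: le_trans|];
  case: (run_step run i) => -[_ h] //; rewrite h.
Qed.

Lemma run_count_homo : {homo c : i j / (i <= j)%N >-> (i <= j)%N}.
Proof.
by apply: homo_leq => [//|i j k /leq_trans|i]; [exact|];
  case: (run_step run i) => -[h _]; rewrite h.
Qed.

Lemma run_count_between m i m' : (m <= i <= m')%N -> c m = c m' -> c i = c m.
Proof.
move=> /andP[mi im'] cc; apply/eqP; rewrite eqn_leq.
by rewrite {1}cc !run_count_homo.
Qed.

Lemma run_vbound_ge0 : 0 <= B.
Proof. exact: le_trans (normr_ge0 _) (run_vel_bounded run 0%N). Qed.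

(** Without jumps the increments are, up to [e], weighted sums of velocities, which
    are bounded by [B]. *)
Lemma run_lipschitz e : 0 < e -> \forall m0 \near \oo, forall m m',
  (m0 <= m <= m')%N -> c m = c m' -> t m' <= t m + w ->
  `|x m' - x m| <= B * (t m' - t m) + e.
Proof.
move=> e0; apply: filterS (run_drift run e0) => m0 h m m' mm' cc tt.
have := h m m' mm' cc tt.
have /andP[_ mm] := mm'.
have := wsum_le run_time_homo mm (run_vel_bounded run).
set S := \sum_(_ <= _ < _) _ => h1 h2.
rewrite -(subrK S (x m' - x m)); apply: le_trans (ler_normD _ _) _.
by rewrite addrC lerD.
Qed.

(** The length [t + j] of hybrid time, along which the run is unbounded even when
    one of the two coordinates stays bounded. *)
Definition hybrid_time (m : nat) : R := t m + (c m)%:R.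

Lemma hybrid_time_homo : {homo hybrid_time : i j / (i <= j)%N >-> i <= j}.
Proof.
by move=> i j ij; rewrite lerD ?run_time_homo// ler_nat run_count_homo.
Qed.

Lemma hybrid_time_step :
  \forall m \near \oo, hybrid_time m.+1 <= hybrid_time m + 1.
Proof.
apply: filterS ((cvgr0Pnorm_le _).1 (run_mesh run) 1 ltr01) => m.
rewrite /hybrid_time; case: (run_step run m) => -[-> h].
  by rewrite /= ger0_norm ?subr_ge0//; lra.
by rewrite h -addn1 natrD addrA.
Qed.

Lemma hybrid_time_pinfty : hybrid_time @ \oo --> +oo.
Proof.
apply/cvgryPge => a; have [m am] := run_diverges run a.
by exists m => // m' /= /hybrid_time_homo; apply: le_trans.
Qed.

Lemma first_passage : \forall m0 \near \oo, forall m a,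
  (m0 <= m)%N -> hybrid_time m <= a ->
  exists2 m', (m <= m')%N & a <= hybrid_time m' <= a + 1.
Proof.
have [m0 _ m0P] := hybrid_time_step.
exists m0 => // m1 /= m01 m a m1m.
rewrite le_eqVlt => /predU1P[<-|ma].
  by exists m => //; rewrite lexx/= lerDl.
have [m2 m2P] := run_diverges run a.
have [m2m|mm2] := leqP m2 m.
  have := hybrid_time_homo m2m; have : a <= hybrid_time m2 by []; lra.
have [|m' /andP[mm' _] /andP[h1 h2]] := @crossing _ hybrid_time a m m2 (ltnW mm2).
  by rewrite ma.
exists m'.+1; first exact: leqW.
rewrite h2/=; apply: (@le_trans _ _ (hybrid_time m' + 1)); last by lra.
by apply: m0P; rewrite /= (leq_trans m01)// (leq_trans m1m).
Qed.

Variable F : set_system nat.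
Hypothesis FF : UltraFilter F.
Variable M : nat -> nat.
Hypothesis Moo : M @ F --> \oo.

Let FP : ProperFilter F. Proof. exact: ultra_proper. Qed.
#[local] Existing Instance FP.

(** Seen from the index [M i], the index [N i] is reached after exactly [k] jumps and
    at a time tending to [s]: the pairs [(s, k)] are the points of the graphical limit
    of the domains of the pieces of the run that start at [M i]. *)
Definition track (N : nat -> nat) (k : nat) (s : R) : Prop :=
  (\forall i \near F, (M i <= N i)%N /\ c (N i) = (c (M i) + k)%N) /\
  t (N i) - t (M i) @[i --> F] --> s.

Lemma track_oo N k s : track N k s -> N @ F --> \oo.
Proof.
move=> [Nk _]; apply/cvgnyPge => A.
apply: filterS2 Nk ((cvgnyPge M).1 Moo A) => i [MN _] AM.
exact: leq_trans AM MN.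
Qed.

(** A bounded hybrid time leaves finitely many possible jump counts, one of which
    is taken along the ultrafilter; the elapsed times are bounded and converge. *)
Lemma track_bounded (N : nat -> nat) (K : R) :
  (\forall i \near F, (M i <= N i)%N /\
     hybrid_time (N i) - hybrid_time (M i) <= K) ->
  exists k s, track N k s.
Proof.
move=> NK.
have [k kP] : exists k, \forall i \near F, (c (N i) - c (M i))%N = k.
  apply: (@ultra_cst F FF _ (Num.bound K)).
  apply: filterS NK => i [MN].
  have := run_count_homo MN => cc.
  have := run_time_homo MN => tt hK.
  rewrite -(ler_nat R) natrB//.
  have K0 : 0 <= K.
    by apply: le_trans hK; rewrite subr_ge0 hybrid_time_homo.
  have := archi_boundP K0; rewrite /hybrid_time in hK *; lra.
have [s sP] : exists s : R, t (N i) - t (M i) @[i --> F] --> s.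
  apply: (@ultra_cvg_real F FF R _ 0 K).
  apply: filterS NK => i [MN hK]; rewrite subr_ge0 run_time_homo//=.
  apply: le_trans hK; rewrite /hybrid_time.
  by have := run_count_homo MN; rewrite -(ler_nat R); lra.
exists k, s; split => //.
apply: filterS2 NK kP => i [MN _] <-; split => //.
by rewrite subnKC// run_count_homo.
Qed.

Lemma track_start : track M 0 0.
Proof.
split; first by apply: nearW => i; rewrite addn0.
by under eq_fun do rewrite subrr; exact: cvg_cst.
Qed.

Lemma track_ge0 N k s : track N k s -> 0 <= s.
Proof.
move=> [Nk Ns]; apply: cvgr_to_ge Ns _.
by apply: filterS Nk => i [MN _]; rewrite subr_ge0 run_time_homo.
Qed.

Lemma track_passage (a : R) : exists N k s, track N k s /\ a <= s + k%:R.
Proof.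
pose b := Num.max a 0.
have [N NP] : exists N : nat -> nat, \forall i \near F, (M i <= N i)%N /\
    hybrid_time (M i) + b <= hybrid_time (N i) <= hybrid_time (M i) + b + 1.
  apply: (@near_choice F _ (fun i m => (M i <= m)%N /\
    hybrid_time (M i) + b <= hybrid_time m <= hybrid_time (M i) + b + 1)).
  have [m0 _ m0P] := first_passage.
  apply: filterS ((cvgnyPge M).1 Moo m0) => i m0M.
  have [||m' h1 h2] := m0P m0 (leqnn _) (M i) (hybrid_time (M i) + b).
  - by [].
  - by rewrite lerDl le_max lexx orbT.
  - by exists m'.
have [k [s Nks]] : exists k s, track N k s.
  apply: (@track_bounded _ (b + 1)); apply: filterS NP => i [h1 h2].
  by split => //; lra.
exists N, k, s; split => //; case: Nks => Nk Ns.
apply: (@le_trans _ _ b); first by rewrite le_max lexx.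
rewrite -lerBlDr; apply: cvgr_to_ge Ns _.
apply: filterS2 NP Nk => i [_ h2] [_ h3].
by move: h2; rewrite /hybrid_time h3 natrD; lra.
Qed.

Lemma track_mono N1 N2 k1 k2 s1 s2 : track N1 k1 s1 -> track N2 k2 s2 ->
  (k1 < k2)%N -> s1 <= s2.
Proof.
move=> [Nk1 Ns1] [Nk2 Ns2] k12.
apply: (@ler_cvg_to nat F _ _ _ _ _ _ Ns1 Ns2).
apply: filterS2 Nk1 Nk2 => i [_ h1] [_ h2].
rewrite lerD2r run_time_homo// leqNgt; apply/negP => /ltnW/run_count_homo.
by rewrite h1 h2 leq_add2l leqNgt k12.
Qed.

(** The time of the run crosses [t (M i) + s] by flow steps between [N1 i] and
    [N2 i], and their size tends to 0, so both ends of the crossing step track [s]. *)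
Lemma track_itv N1 N2 k s1 s2 s : track N1 k s1 -> track N2 k s2 ->
  s1 < s < s2 -> exists N, track N k s /\ track (S \o N) k s.
Proof.
move=> T1 T2 /andP[s1s ss2].
have [N NP] : exists N : nat -> nat, \forall i \near F,
    (N1 i <= N i < N2 i)%N /\ t (N i) < t (M i) + s <= t (N i).+1.
  apply: (@near_choice F _ (fun i m =>
    (N1 i <= m < N2 i)%N /\ t m < t (M i) + s <= t m.+1)); near=> i.
  have h1 : t (N1 i) < t (M i) + s.
    by rewrite -ltrBlDl; near: i; exact: (cvgr_lt _ T1.2).
  have h2 : t (M i) + s < t (N2 i).
    by rewrite -ltrBrDl; near: i; exact: (cvgr_gt _ T2.2).
  have N12 : (N1 i <= N2 i)%N.
    rewrite leqNgt; apply/negP => /ltnW/run_time_homo; lra.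
  have [|m h3 h4] := crossing N12 (a := t (M i) + s) (f := t).
    by rewrite h1 ltW.
  by exists m.
have NN1 : \forall i \near F, (M i <= N i)%N.
  by apply: filterS2 NP T1.1 => i [/andP[h _] _] [h' _]; exact: leq_trans h.
have Noo : N @ F --> \oo.
  apply/cvgnyPge => A; apply: filterS2 NN1 ((cvgnyPge M).1 Moo A) => i MN AM.
  exact: leq_trans AM MN.
have mesh : t (N i).+1 - t (N i) @[i --> F] --> 0.
  exact: cvg_comp Noo (run_mesh run).
have Nc : \forall i \near F, c (N i) = (c (M i) + k)%N /\
    c (N i).+1 = (c (M i) + k)%N.
  near=> i.
  have [_ c1] : (M i <= N1 i)%N /\ c (N1 i) = (c (M i) + k)%N.
    by near: i; case: T1.
  have [_ c2] : (M i <= N2 i)%N /\ c (N2 i) = (c (M i) + k)%N.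
    by near: i; case: T2.
  have [/andP[n1 n2] _] : (N1 i <= N i < N2 i)%N /\
    t (N i) < t (M i) + s <= t (N i).+1 by near: i.
  by rewrite -c1; split; apply: (@run_count_between _ _ (N2 i));
    rewrite ?c1 ?c2// ?n1 ?n2 ?(leqW n1) ?(ltnW n2).
have Ns : t (N i) - t (M i) @[i --> F] --> s.
  apply: (@squeeze_cvgr _ F _ _ (fun i => s - (t (N i).+1 - t (N i))) (cst s)).
  - by apply: filterS NP => i [_ h] /=; lra.
  - by rewrite -[X in _ --> X]subr0; apply: cvgB => //; exact: cvg_cst.
  - exact: cvg_cst.
exists N; split; split => //.
- by apply: filterS2 NN1 Nc => i ? [].
- by apply: filterS2 NN1 Nc => i /leqW ? [].
- rewrite -[X in _ --> X]addr0.
  rewrite (_ : (fun _ => _) = (fun i => (t (N i) - t (M i)) + (t (N i).+1 - t (N i)))).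
    exact: cvgD.
  by apply/funext => i /=; ring.
Unshelve. all: by end_near. Qed.

(** The jump number [k + 1] after [M i] takes no time and happens before [N i], so
    its time stays bounded and its two ends are tracks on consecutive levels. *)
Lemma track_jump N k s : track N k.+1 s ->
  exists N' s', track N' k s' /\ track (S \o N') k.+1 s'.
Proof.
move=> [Nk Ns].
have [N' NP] : exists N' : nat -> nat, \forall i \near F,
    [/\ (M i <= N' i < N i)%N, c (N' i) = (c (M i) + k)%N &
        c (N' i).+1 = (c (M i) + k.+1)%N].
  apply: (@near_choice F _ (fun i m => [/\ (M i <= m < N i)%N,
    c m = (c (M i) + k)%N & c m.+1 = (c (M i) + k.+1)%N])); apply: filterS Nk => i [MN cN].
  have [|m /andP[h1 h2] h3] := @crossing R (fun m => (c m)%:R)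
      (c (M i) + k.+1)%:R _ _ MN.
    by rewrite cN lexx ltr_nat addnS ltnS leq_addr.
  exists m; move: h3; rewrite ltr_nat ler_nat => h3.
  by case: (run_step run m) => -[h _]; split; rewrite ?h1 ?h2 ?h //; lia.
have [s' N's] : exists s' : R, t (N' i) - t (M i) @[i --> F] --> s'.
  apply: (@ultra_cvg_real F FF R _ 0 (s + 1)).
  have Nlt : \forall i \near F, t (N i) - t (M i) <= s + 1.
    by apply: (cvgr_le _ Ns); rewrite ltrDl.
  apply: filterS2 NP Nlt => i [/andP[/run_time_homo h1 /ltnW/run_time_homo h2] _ _].
  by lra.
exists N', s'; split; split => //.
- by apply: filterS NP => i [/andP[]].
- by apply: filterS NP => i [/andP[/leqW]].
- apply: cvg_trans N's; apply: near_eq_cvg; apply: filterS NP => i [_ h1 h2] /=.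
  by case: (run_step run (N' i)) => -[h3 h4]; [lia|rewrite h4].
Qed.

(** For [s1 = s2] this shows that the limit of the run does not depend on the
    track. *)
Lemma track_close N1 N2 k s1 s2 (z1 z2 : 'rV[R]_n) :
  track N1 k s1 -> track N2 k s2 -> `|s2 - s1| < w ->
  x (N1 i) @[i --> F] --> z1 -> x (N2 i) @[i --> F] --> z2 ->
  `|z2 - z1| <= B * `|s2 - s1|.
Proof.
move=> T1 T2 s12 x1 x2; apply/ler_addgt0Pr => e e0.
have tt : `|t (N2 i) - t (N1 i)| @[i --> F] --> `|s2 - s1|.
  apply: cvg_norm.
  rewrite (_ : (fun _ => _) = (fun i => (t (N2 i) - t (M i)) - (t (N1 i) - t (M i)))).
    by apply: cvgB; [case: T2|case: T1].
  by apply/funext => i /=; ring.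
apply: (@ler_cvg_to nat F _ _ (fun i => `|x (N2 i) - x (N1 i)|)
    (fun i => B * `|t (N2 i) - t (N1 i)| + e)).
- by apply: cvg_norm; exact: cvgB.
- by apply: cvgD; [apply: cvgMr|exact: cvg_cst].
have [m0 _ m0P] := run_lipschitz e0.
near=> i.
have N1m : (m0 <= N1 i)%N by near: i; exact: (cvgnyPge N1).1 (track_oo T1) m0.
have N2m : (m0 <= N2 i)%N by near: i; exact: (cvgnyPge N2).1 (track_oo T2) m0.
have [_ c1] : (M i <= N1 i)%N /\ c (N1 i) = (c (M i) + k)%N.
  by near: i; case: T1.
have [_ c2] : (M i <= N2 i)%N /\ c (N2 i) = (c (M i) + k)%N.
  by near: i; case: T2.
have tw : `|t (N2 i) - t (N1 i)| <= w by near: i; exact: (cvgr_le _ tt).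
have [n12|/ltnW n21] := leqP (N1 i) (N2 i).
- have tle := run_time_homo n12; rewrite ger0_norm ?subr_ge0// in tw *.
  by apply: (m0P m0) => //=; rewrite ?leqnn ?N1m ?n12 ?c1 ?c2//; lra.
- have tle := run_time_homo n21; rewrite distrC [X in B * X]distrC.
  rewrite distrC ger0_norm ?subr_ge0// in tw.
  rewrite (ger0_norm (_ : 0 <= t (N1 i) - t (N2 i))) ?subr_ge0//.
  by apply: (m0P m0) => //=; rewrite ?leqnn ?N2m ?n21 ?c1 ?c2//; lra.
Unshelve. all: by end_near. Qed.

End Run.

(** * Hybrid time domains from their levels *)

Section HybridTimeDomains.
Variables (R : realType) (E : set (R * nat)).
Hypothesis E0 : E (0, 0%N).
Hypothesis E_ge0 : forall s k, E (s, k) -> 0 <= s.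
Hypothesis E_itv : forall s1 s2 s k,
  E (s1, k) -> E (s2, k) -> s1 <= s <= s2 -> E (s, k).
Hypothesis E_mono : forall s1 s2 k1 k2,
  E (s1, k1) -> E (s2, k2) -> (k1 < k2)%N -> s1 <= s2.
Hypothesis E_jump : forall s k, E (s, k.+1) ->
  exists s', E (s', k) /\ E (s', k.+1).
Hypothesis E_complete : forall a, exists s k, E (s, k) /\ a <= s + k%:R.

(** [E] is the union of its levels [E (_, k)].  Levels are intervals, [E_mono] orders
    them, and [E_jump] lets two consecutive nonempty levels meet; by [E_mono] they meet
    in one time only, the time [T k.+1] of the jump.  Hence a level followed by another
    one is the segment from [T k] to [T k.+1], and completeness makes a last level, if
    there is one, a half-line, which is exhausted by the segments of length [i]. *)
Lemma staircase_hybrid_time_domain : hybrid_time_domain E.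
Proof.
pose T k := if k is k'.+1 then xget 0 [set s | E (s, k') /\ E (s, k'.+1)] else 0.
pose L k := exists s, E (s, k).
have TP k : L k.+1 -> E (T k.+1, k) /\ E (T k.+1, k.+1).
  move=> [s /E_jump h].
  exact: (xgetPex 0 (h : [set s | E (s, k) /\ E (s, k.+1)] !=set0)).
have L0 : L 0%N by exists 0.
have TE k : L k -> E (T k, k) by case: k => // k /TP[].
have L_pred k : L k.+1 -> L k by move/TP => [h _]; exists (T k.+1).
have L_le k1 k2 : (k1 <= k2)%N -> L k2 -> L k1.
  elim: k2 => [|k2 IH]; first by rewrite leqn0 => /eqP ->.
  rewrite leq_eqVlt ltnS => /predU1P[-> //|k12 /L_pred].
  exact: IH.
have T_le s k : E (s, k) -> T k <= s.
  case: k => [|k] Es; first exact: E_ge0 Es.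
  have [h _] : E (T k.+1, k) /\ E (T k.+1, k.+1) by apply: TP; exists s.
  exact: E_mono h Es (ltnSn _).
have le_T s k : E (s, k) -> L k.+1 -> s <= T k.+1.
  by move=> Es /TP[_ h]; exact: E_mono Es h (ltnSn _).
have levelE k s : L k.+1 -> (E (s, k) <-> T k <= s <= T k.+1).
  move=> Lk; split => [Es|].
    by rewrite (T_le _ _ Es) le_T.
  exact: E_itv (TE _ (L_pred _ Lk)) (TP k Lk).1.
have [allL|] := pselect (forall k, L k).
  exists (fun i => \bigcup_(j in [set j | (j < i.+1)%N]) (`[T j, T j.+1] `*` [set j])).
    split=> [i|i p [j /= ji pj]]; last by exists j => //=; exact: leqW.
    exists i.+1, T; split => // j _.
    by apply: le_T; [exact: TE|exact: allL].
  apply/seteqP; split => [[s k] Es|[s k] [i _ [j _ [/= h ->]]]].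
    exists k => //; exists k => //=; split => //=.
    by rewrite in_itv/=; apply/levelE.
  by apply/levelE => //; rewrite in_itv/= in h.
move/existsNP => [k0 nLk0].
have exK : exists k, ~~ `[< L k >] by exists k0; apply/asboolPn.
case: (ex_minnP exK) => -[|K]; first by move/asboolPn.
move=> /asboolPn nLK minK.
have LK k : (k <= K)%N -> L k.
  move=> kK; apply: contrapT => nLk.
  by have := minK k (introT (asboolPn _) nLk); rewrite ltnNge kK.
have EK s k : E (s, k) -> (k <= K)%N.
  move=> Es; rewrite leqNgt; apply/negP => Kk.
  by apply: nLK; apply: L_le Kk _; exists s.
(* The last level, which is a half-line, is truncated at length [i]. *)
pose T' i k := if (k <= K)%N then T k else T K + i%:R.
have lastE s : T K <= s -> E (s, K).
  move=> TKs; have [s' [k [Es' h]]] := E_complete (s + K%:R).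
  have kK := EK _ _ Es'; have h' : s <= s' by move: kK; rewrite -(ler_nat R); lra.
  have Es'K : E (s', K).
    have := kK; rewrite leq_eqVlt => /predU1P[<-//|ltkK].
    have : s' <= T K := E_mono Es' (TE _ (LK _ (leqnn _))) ltkK.
    move=> s'T; rewrite (_ : s' = T K); first exact/TE/LK.
    by apply/eqP; rewrite eq_le s'T (le_trans TKs).
  by apply: E_itv (TE _ (LK _ (leqnn _))) Es'K _; rewrite TKs.
have T'_lt i k : (k < K)%N -> T' i k.+1 = T k.+1 by move=> kK; rewrite /T' kK.
have T'_le i k : (k <= K)%N -> T' i k = T k by move=> kK; rewrite /T' kK.
have T'_last i : T' i K.+1 = T K + i%:R by rewrite /T' ltnn.
exists (fun i => \bigcup_(j in [set j | (j < K.+1)%N])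
          (`[T' i j, T' i j.+1] `*` [set j])).
  split=> [i|i [s k] [j /= jK [/= h ->]]].
    exists K.+1, (T' i); split => // j; rewrite ltnS => jK.
    rewrite (T'_le _ _ jK); move: jK; rewrite leq_eqVlt => /predU1P[->|jK].
      by rewrite T'_last lerDl ler0n.
    by rewrite T'_lt//; apply: le_T (LK _ _) => //; exact/TE/LK/ltnW.
  exists j => //=; split => //=; move: h; rewrite /= !in_itv/= => /andP[h1 h2].
  rewrite ltnS in jK; rewrite (T'_le _ _ jK) in h1; rewrite (T'_le _ _ jK) h1/=.
  apply: le_trans h2 _; move: jK; rewrite leq_eqVlt => /predU1P[->|jK].
    by rewrite !T'_last lerD2l ler_nat.
  by rewrite !T'_lt.
apply/seteqP; split => [[s k] Es|[s k] [i _ [j /= jK [/= h ->]]]].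
  have kK := EK _ _ Es.
  exists (Num.bound (s - T K)) => //; exists k => //=; split => //=.
  rewrite in_itv/= T'_le// (T_le _ _ Es)/=.
  move: kK; rewrite leq_eqVlt => /predU1P[kK|kK].
    rewrite kK T'_last -lerBlDl ltW// archi_boundP// subr_ge0 -kK.
    exact: T_le.
  by rewrite T'_lt//; apply: le_T => //; exact: LK.
rewrite ltnS in jK; move: h; rewrite in_itv/= (T'_le _ _ jK).
move: jK; rewrite leq_eqVlt => /predU1P[->|jK] /andP[h1 h2].
  exact: lastE.
by apply/levelE; [exact: LK|rewrite h1 -(T'_lt i)].
Qed.

End HybridTimeDomains.

(** * The limit arc *)

Section LimitArc.
Variables (R : realType) (n : nat) (H : hybrid_inclusion R n).
Variables (x : nat -> 'rV[R]_n) (t : nat -> R) (c : nat -> nat).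
Variables (g : nat -> 'rV[R]_n) (X B w : R).
Hypothesis run : asymptotic_run H x t c g X B w.

(** Otherwise some velocities taken at points tending to [p] stay away from
    [flow_map H p], although their limit along an ultrafilter lies in it. *)
Lemma run_vel_near (p : 'rV[R]_n) (e : R) : 0 < e ->
  exists2 d : R, 0 < d & \forall m0 \near \oo, forall m,
    (m0 <= m)%N -> c m.+1 = c m -> `|x m - p| <= d ->
    exists2 a, flow_map H p a & `|g m - a| <= e.
Proof.
move=> e0; apply: contrapT => nd.
have bad (j : nat) : exists m, [/\ (j <= m)%N, c m.+1 = c m,
    `|x m - p| <= j.+1%:R^-1 &
    forall a, flow_map H p a -> e < `|g m - a|].
  apply: contrapT => nm; apply: nd; exists j.+1%:R^-1; first by rewrite invr_gt0.
  exists j => // j' /= jj' m j'm cm xm; apply: contrapT => na.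
  apply: nm; exists m; split => //; first exact: leq_trans jj' j'm.
  by move=> a Fa; rewrite ltNge; apply/negP => ga; apply: na; exists a.
have [N NP] := choice bad.
have [G [GU Goo]] := ultraFilterLemma (eventually_filter).
have GP : ProperFilter G := @ultra_proper _ _ GU.
have Noo : N @ G --> \oo.
  apply/cvgnyPge => A; have : G [set j | (A <= j)%N] by apply: Goo; exists A.
  by apply: filterS => j /= /leq_trans; apply; case: (NP j).
have [v gv] : exists v : 'rV[R]_n, g (N j) @[j --> G] --> v.
  apply: (ultra_cvg_rV GU (K := B)) => j; exact: run_vel_bounded run _.
have xp : x (N j) @[j --> G] --> p.
  apply/cvgrPdist_le => /= d d0.
  have : G [set j | j.+1%:R^-1 <= d].
    by apply: Goo; apply: filterS (near_infty_natSinv_lt (PosNum d0)) => j /ltW.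
  by apply: filterS => j /= jd; rewrite distrC; case: (NP j) => _ _ h _; exact: le_trans jd.
have [_ Fv] : flow_set H p /\ flow_map H p v.
  have cN : \forall j \near G, c (N j).+1 = c (N j).
    by apply: nearW => j /=; case: (NP j).
  exact: (run_flow run (F := N @ G)).
have /filter_ex[j /= gj] : \forall j \near G, `|v - g (N j)| <= e.
  exact: cvgr_dist_le gv _ e0.
by case: (NP j) => _ _ _ /(_ _ Fv); rewrite distrC ltNge gj.
Qed.

Variable F : set_system nat.
Hypothesis FF : UltraFilter F.
Variable M : nat -> nat.
Hypothesis Moo : M @ F --> \oo.

Let FP : ProperFilter F. Proof. exact: ultra_proper. Qed.
#[local] Existing Instance FP.

Notation track := (track t c F M).

Definition limit_dom : set (R * nat) := [set p | exists N, track N p.2 p.1].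
Definition limit_val (p : R * nat) : 'rV[R]_n :=
  xget 0 [set z : 'rV[R]_n | exists2 N, track N p.2 p.1 & x (N i) @[i --> F] --> z].

Lemma limit_valP N k s : track N k s -> x (N i) @[i --> F] --> limit_val (s, k).
Proof.
move=> T.
have [z xz] : exists z : 'rV[R]_n, x (N i) @[i --> F] --> z.
  apply: (ultra_cvg_rV FF (K := X)) => i; exact: run_bounded run _.
have [N' T' xz'] : exists2 N', track N' k s & x (N' i) @[i --> F] --> limit_val (s, k).
  apply: (xgetPex 0 (P := [set z : 'rV[R]_n | exists2 N, track N k s & x (N i) @[i --> F] --> z])).
  by exists z, N.
have : `|z - limit_val (s, k)| <= B * `|s - s|.
  by apply: (track_close run FF Moo T' T) xz' xz; rewrite subrr normr0 (run_window run).
by rewrite subrr normr0 mulr0 normr_le0 subr_eq0 => /eqP <-.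
Qed.

Lemma limit_dom_itv s1 s2 s k : limit_dom (s1, k) -> limit_dom (s2, k) ->
  s1 <= s <= s2 -> limit_dom (s, k).
Proof.
move=> [N1 T1] [N2 T2] /andP[].
rewrite le_eqVlt => /predU1P[<- _|s1s]; first by exists N1.
rewrite le_eqVlt => /predU1P[->|ss2]; first by exists N2.
have [|N [T _]] := track_itv run FF Moo T1 T2 (s := s); first by rewrite s1s.
by exists N.
Qed.

Lemma limit_dom_htd : hybrid_time_domain limit_dom.
Proof.
apply: staircase_hybrid_time_domain.
- by exists M; exact: track_start.
- by move=> s k [N /= /(track_ge0 run FF)].
- by move=> s1 s2 s k; exact: limit_dom_itv.
- by move=> s1 s2 k1 k2 [N1 /= T1] [N2 /= T2]; exact: (track_mono run FF T1 T2).
- move=> s k [N /= /(track_jump run FF)[N' [s' [T T']]]].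
  by exists s'; split; [exists N'|exists (S \o N')].
- move=> a; have [N [k [s [T h]]]] := track_passage run FF Moo a.
  by exists s, k; split => //; exists N.
Qed.

(** The window [w] only bounds increments over short times, so longer ones are cut
    into pieces of length [w / 2]. *)
Lemma limit_lipschitz k s1 s2 : limit_dom (s1, k) -> limit_dom (s2, k) ->
  s1 <= s2 ->
  `|limit_val (s2, k) - limit_val (s1, k)| <= B * (s2 - s1).
Proof.
have w0 := run_window run.
suff h (m : nat) : forall s1 s2, limit_dom (s1, k) -> limit_dom (s2, k) ->
    s1 <= s2 -> s2 - s1 <= m%:R * (w / 2) ->
    `|limit_val (s2, k) - limit_val (s1, k)| <= B * (s2 - s1).
  move=> D1 D2 s12; apply: (h (Num.bound ((s2 - s1) / (w / 2)))) => //.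
  rewrite -ler_pdivrMr ?divr_gt0// ltW// archi_boundP//.
  by rewrite divr_ge0 ?subr_ge0// divr_ge0// ltW.
elim: m => [|m IH] {}s1 {}s2 D1 D2 s12 hs.
  have -> : s2 = s1 by apply/eqP; rewrite eq_le s12 andbT; lra.
  by rewrite !subrr normr0 mulr0.
have [s1w|s1w] := ltP (s2 - s1) w.
  have [N1 T1] := D1; have [N2 T2] := D2.
  have /= := track_close run FF Moo T1 T2 _ (limit_valP T1) (limit_valP T2).
  by rewrite (ger0_norm (_ : 0 <= s2 - s1)) ?subr_ge0//; apply.
pose s := s1 + w / 2.
have [N1 /= T1] := D1; have [N2 /= T2] := D2.
have [|N [T _]] := track_itv run FF Moo T1 T2 (s := s).
  by rewrite /s; apply/andP; split; lra.
have D : limit_dom (s, k) by exists N.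
have h1 : `|limit_val (s2, k) - limit_val (s, k)| <= B * (s2 - s).
  by apply: IH => //; rewrite /s; [lra|move: hs; rewrite -addn1 natrD; lra].
have h2 : `|limit_val (s, k) - limit_val (s1, k)| <= B * (s - s1).
  have /= := track_close run FF Moo T1 T _ (limit_valP T1) (limit_valP T).
  by rewrite ger0_norm /s; [apply; lra|lra].
rewrite (_ : s2 - s1 = (s2 - s) + (s - s1)); last by ring.
rewrite mulrDr -(subrK (limit_val (s, k)) (limit_val (s2, k))) -addrA.
by apply: le_trans (ler_normD _ _) _; exact: lerD.
Qed.

Lemma limit_ac k (s1 s2 : R) : limit_dom (s1, k) -> limit_dom (s2, k) ->
  s1 < s2 -> absolutely_continuous_on (fun s => limit_val (s, k)) s1 s2.
Proof.
move=> D1 D2 _ e e0.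
have B0 := run_vbound_ge0 run.
pose L := n.+1%:R * (B + 1).
have L0 : 0 < L by rewrite mulr_gt0// ltr_wpDl.
exists (e / L); first by rewrite divr_gt0.
move=> m a b ab _; rewrite ltr_pdivlMr// => abe.
apply: le_lt_trans abe; rewrite mulr_suml; apply: ler_sum => i _.
have [a1 [aib b2]] := ab i.
apply: le_trans (enorm_le_norm _) _.
rewrite /L [leRHS]mulrC -mulrA ler_wpM2l//.
apply: (@le_trans _ _ (B * (b i - a i))); last first.
  by rewrite ler_wpM2r ?subr_ge0// lerDl.
apply: limit_lipschitz => //; apply: (limit_dom_itv D1 D2).
  by rewrite a1 (le_trans aib).
by rewrite b2 (le_trans a1).
Qed.

Definition limit_arc : hybrid_arc R n := HybridArc limit_dom_htd limit_ac.

Lemma limit_arc_complete : arc_complete limit_arc.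
Proof.
move=> [b bP].
have [N [k [s [T h]]]] := track_passage run FF Moo (b + 1).
have : s + k%:R <= b by apply: bP; exists (s, k) => //; exists N.
lra.
Qed.

Lemma limit_jump s k : limit_dom (s, k) -> limit_dom (s, k.+1) ->
  jump_set H (limit_val (s, k)) /\
  jump_map H (limit_val (s, k)) (limit_val (s, k.+1)).
Proof.
move=> [N1 T1] [N2 T2].
have [N [s' [T T']]] := track_jump run FF T2.
have ss' : s = s'.
  apply/eqP; rewrite eq_le (track_mono run FF T1 T' (ltnSn _)).
  by rewrite (track_mono run FF T T2 (ltnSn _)).
rewrite -ss' in T T'.
apply: (run_jump run (F := N @ F)).
- exact: track_oo T.
- by apply: filterS2 T.1 T'.1 => i [_ h1] [_ /= h2]; rewrite h1 h2 addnS.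
- exact: limit_valP T.
- exact: limit_valP T'.
Qed.

(** At an interior time the track can be chosen to make flow steps, at which the
    velocities have a limit along the ultrafilter. *)
Lemma limit_flow_set s1 s2 s k : limit_dom (s1, k) -> limit_dom (s2, k) ->
  s1 < s < s2 ->
  flow_set H (limit_val (s, k)) /\ flow_map H (limit_val (s, k)) !=set0.
Proof.
move=> [N1 T1] [N2 T2] ss; have [N [T T']] := track_itv run FF Moo T1 T2 ss.
have [v gv] : exists v : 'rV[R]_n, g (N i) @[i --> F] --> v.
  apply: (ultra_cvg_rV FF (K := B)) => i; exact: run_vel_bounded run _.
have [Cp Fp] : flow_set H (limit_val (s, k)) /\ flow_map H (limit_val (s, k)) v.
  apply: (run_flow run (F := N @ F)) => //.
  - exact: track_oo T.
  - by apply: filterS2 T.1 T'.1 => i [_ h1] [_ /= h2]; rewrite h1 h2.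
  - exact: limit_valP T.
by split => //; exists v.
Qed.

(** The ultrafilter contains either the [i] for which the run flows at [M i] or
    those for which it jumps there. *)
Lemma limit_init : (flow_set H `|` jump_set H) (limit_val (0, 0%N)).
Proof.
have T0 := track_start t c FF M.
have [h|h] := in_ultra_setVsetC [set i | c (M i).+1 = c (M i)] FF.
  left; have [v gv] : exists v : 'rV[R]_n, g (M i) @[i --> F] --> v.
    apply: (ultra_cvg_rV FF (K := B)) => i; exact: run_vel_bounded run _.
  by have [] := run_flow run (F := M @ F) _ Moo h (limit_valP T0) gv.
right; have [q xq] : exists q : 'rV[R]_n, x (M i).+1 @[i --> F] --> q.
  apply: (ultra_cvg_rV FF (K := X)) => i; exact: run_bounded run _.
have cM : \forall i \near F, c (M i).+1 = (c (M i)).+1.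
  by apply: filterS h => i nh; case: (run_step run (M i)) => -[h1 _].
by have [] := run_jump run (F := M @ F) _ Moo cM (limit_valP T0) xq.
Qed.

End LimitArc.

(** * The limit arc is a solution *)

Lemma osc_closed (R : realType) (n : nat) (G : 'rV[R]_n -> set 'rV[R]_n) p v :
  outer_semicontinuous G ->
  (forall e, 0 < e -> exists2 a, G p a & `|v - a| <= e) -> G p v.
Proof.
move=> oscG Gv.
have near_v (j : nat) : exists a, G p a /\ `|v - a| <= j.+1%:R^-1.
  by have [|a Ga va] := Gv j.+1%:R^-1; [rewrite invr_gt0|exists a].
have [a aP] := choice near_v.
apply: (oscG (cst p) a) => [||j]; first exact: cvg_cst.
- apply/cvgrPdist_le => /= d d0.
  apply: filterS (near_infty_natSinv_lt (PosNum d0)) => j /ltW jd.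
  by case: (aP j) => _ /le_trans; apply.
- by case: (aP j).
Qed.

(** Here [q] stands for the increment of the run, [S] for the weighted sum of its
    velocities and [s] for its duration, known to exceed half of its limit [h]. *)
Lemma average_estimate (R : realType) (n : nat) (u q S a : 'rV[R]_n)
    (s h e : R) : 0 <= e -> 0 < h -> h / 2 < s ->
  `|u - s^-1 *: q| <= e -> `|q - S| <= e * (h / 2) -> `|S - s *: a| <= e * s ->
  `|u - a| <= e + (e + e).
Proof.
move=> e0 h0 hs us qS Sa.
have s0 : 0 < s by lra.
have -> : u - a = (u - s^-1 *: q) + s^-1 *: ((q - S) + (S - s *: a)).
  rewrite [q - S + _]addrA subrK [_ *: (q - s *: a)]scalerBr scalerA.
  by rewrite mulVf ?gt_eqF// scale1r addrA subrK.
apply: le_trans (ler_normD _ _) _; apply: lerD => //.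
rewrite normrZ gtr0_norm ?invr_gt0// ler_pdivrMl//.
apply: le_trans (ler_normD _ _) _; rewrite mulrDr [s * e]mulrC; apply: lerD => //.
by apply: le_trans qS _; rewrite ler_wpM2l// ltW.
Qed.

Lemma derivable_quotient_cvg (R : realType) (n : nat) (f : R -> 'rV[R]_n) r :
  derivable f r 1 ->
  h^-1 *: (f (h + r) - f r) @[h --> 0^'] --> derive1 f r.
Proof.
move=> df.
suff : cvg (h^-1 *: (f (h + r) - f r) @[h --> 0^']) by [].
move: df; rewrite /derivable.
have -> : (fun h : R => h^-1 *: ((f \o shift r) (h *: (1 : R)) - f r)) =
    (fun h : R => h^-1 *: (f (h + r) - f r)).
  by apply/funext => h /=; rewrite [h *: (1 : R)]mulr1.
by [].
Qed.

Section LimitSolution.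
Variables (R : realType) (n : nat) (H : hybrid_inclusion R n).
Variables (x : nat -> 'rV[R]_n) (t : nat -> R) (c : nat -> nat).
Variables (g : nat -> 'rV[R]_n) (X B w : R).
Hypothesis HBC : hybrid_basic_conditions H.
Hypothesis run : asymptotic_run H x t c g X B w.
Variable F : set_system nat.
Hypothesis FF : UltraFilter F.
Variable M : nat -> nat.
Hypothesis Moo : M @ F --> \oo.

Let FP : ProperFilter F. Proof. exact: ultra_proper. Qed.
#[local] Existing Instance FP.

Notation track := (track t c F M).
Notation limit_dom := (limit_dom t c F M).
Notation limit_val := (limit_val x t c F M).
Notation limit_arc := (limit_arc run FF Moo).

(** For small [h] the run stays near [p := limit_val (r, k)] between its passages at
    the times [r] and [r + h]: its velocities there are close to the convex set
    [flow_map H p], and so is their average, of which the quotient is a limit. *)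
Lemma limit_quotient k s1 s2 r e : 0 < e ->
  limit_dom (s1, k) -> limit_dom (s2, k) -> s1 < r < s2 ->
  exists2 d : R, 0 < d & forall h, 0 < h -> h < d ->
    exists2 a, flow_map H (limit_val (r, k)) a &
      `|h^-1 *: (limit_val (r + h, k) - limit_val (r, k)) - a| <= e.
Proof.
move=> e0 D1 D2 rs.
have [Cp Fp0] := limit_flow_set run FF Moo D1 D2 rs.
set p := limit_val (r, k) in Cp Fp0 *.
have e30 : 0 < e / 3 by rewrite divr_gt0.
have [d d0 dP] := run_vel_near run p e30.
have w0 := run_window run; have B0 := run_vbound_ge0 run.
have d40 : 0 < d / 4 by rewrite divr_gt0.
exists (Num.min (s2 - r) (Num.min (w / 2) (d / 4 / (2 * (B + 1))))).
  by rewrite !lt_min subr_gt0 !divr_gt0 ?mulr_gt0 ?ltr_wpDl//; case/andP: rs => _ ->.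
move=> h h0; rewrite !lt_min => /and3P[hs2 hw hd].
have hB : B * (2 * h) <= d / 4.
  move: hd; rewrite ltr_pdivlMr ?mulr_gt0 ?ltr_wpDl//; nra.
have h2w : 2 * h <= w by lra.
have d3 : d / 4 + d / 4 + d / 4 <= d by lra.
(* The bounds with [d / 4] below keep the run within [d] of [p]. *)
have rhs : s1 < r + h < s2 by apply/andP; split; lra.
have [N1 /= T1'] := D1; have [N2 /= T2'] := D2.
have [N [T TS]] := track_itv run FF Moo T1' T2' rs.
have [N' [T' _]] := track_itv run FF Moo T1' T2' rhs.
have xN := limit_valP run FF Moo T; rewrite -/p in xN.
have xN' := limit_valP run FF Moo T'.
move: {xN'}(limit_val (r + h, k)) xN' => p' xN'.
clearbody p.
have {xN'} xNN' : x (N' i) - x (N i) @[i --> F] --> p' - p by exact: cvgB.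
have tau : t (N' i) - t (N i) @[i --> F] --> h.
  rewrite (_ : (fun _ => _) = (fun i => (t (N' i) - t (M i)) - (t (N i) - t (M i)))).
    rewrite (_ : h = r + h - r); last by ring.
    by apply: cvgB; [case: T'|case: T].
  by apply/funext => i /=; ring.
have quot : (t (N' i) - t (N i))^-1 *: (x (N' i) - x (N i)) @[i --> F] -->
    h^-1 *: (p' - p).
  by apply: cvgZ; [apply: cvgV => //; rewrite gt_eqF|exact: xNN'].
have eh0 : 0 < e / 3 * (h / 2) by rewrite mulr_gt0// divr_gt0.
have [m1 _ m1P] := dP.
have [m2 _ m2P] := run_drift run eh0.
have [m3 _ m3P] := run_lipschitz run d40.
have /filter_ex[i] : \forall i \near F, exists2 a, flow_map H p a &
    `|h^-1 *: (p' - p) - a| <= e; last by [].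
near=> i.
have Ni1 : (m1 <= N i)%N by near: i; exact: (cvgnyPge N).1 (track_oo FF Moo T) m1.
have Ni2 : (m2 <= N i)%N by near: i; exact: (cvgnyPge N).1 (track_oo FF Moo T) m2.
have Ni3 : (m3 <= N i)%N by near: i; exact: (cvgnyPge N).1 (track_oo FF Moo T) m3.
have tau_gt : h / 2 < t (N' i) - t (N i).
  by near: i; apply: (cvgr_gt _ tau); lra.
have tau_le : t (N' i) - t (N i) <= 2 * h.
  by near: i; apply: (cvgr_le _ tau); lra.
have tw : t (N' i) <= t (N i) + w by rewrite -lerBlDl (le_trans tau_le).
have tBd : B * (t (N' i) - t (N i)) <= d / 4.
  by apply: (le_trans _ hB); rewrite ler_wpM2l.
have NN' : (N i <= N' i)%N.
  rewrite leqNgt; apply/negP => /ltnW/(run_time_homo run).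
  rewrite -subr_le0 => /(lt_le_trans tau_gt).
  by rewrite ltNge divr_ge0// ltW.
have [_ c1] : (M i <= N i)%N /\ c (N i) = (c (M i) + k)%N.
  by near: i; case: T.
have [_ c2] : (M i <= N' i)%N /\ c (N' i) = (c (M i) + k)%N.
  by near: i; case: T'.
have cc : c (N i) = c (N' i) by rewrite c1 c2.
have xNp : `|x (N i) - p| <= d / 4.
  by rewrite distrC; near: i; exact: cvgr_dist_le.
have quot_i : `|h^-1 *: (p' - p) -
    (t (N' i) - t (N i))^-1 *: (x (N' i) - x (N i))| <= e / 3.
  by near: i; exact: cvgr_dist_le.
have [|a Fa Sa] := wsum_near_convex Fp0 (hbc_flow_convex HBC Cp)
    (run_time_homo run) NN' (g := g) (e := e / 3).
  move=> m /andP[Nm mN'].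
  apply: (m1P m1) => //=; first exact: leq_trans Ni1 Nm.
    have h1 : c m = c (N i).
      by apply: (run_count_between run _ cc); rewrite Nm ltnW.
    have h2 : c m.+1 = c (N i).
      by apply: (run_count_between run _ cc); rewrite leqW.
    by rewrite h1 h2.
  have tm' := run_time_homo run (ltnW mN').
  rewrite -(subrK (x (N i)) (x m)) -addrA.
  apply: le_trans (ler_normD _ _) _; apply: (le_trans _ d3); apply: lerD => //.
  apply: (@le_trans _ _ (B * (t m - t (N i)) + d / 4)).
    apply: (m3P m3) => //=; rewrite ?Ni3 ?Nm//; last exact: (le_trans _ tw).
    by apply/esym; apply: (run_count_between run _ cc); rewrite Nm ltnW.
  by rewrite lerD2r; apply: (le_trans _ tBd); rewrite ler_wpM2l// lerD2r.
exists a => //.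
have drift : `|x (N' i) - x (N i) -
    \sum_(N i <= j < N' i) (t j.+1 - t j) *: g j| <= e / 3 * (h / 2).
  by apply: (m2P m2) => //=; rewrite ?Ni2 ?NN'.
have -> : e = e / 3 + (e / 3 + e / 3) by field.
exact: average_estimate (ltW e30) h0 tau_gt quot_i drift Sa.
Unshelve. all: by end_near. Qed.

Lemma limit_derivative k s1 s2 r :
  limit_dom (s1, k) -> limit_dom (s2, k) -> s1 < r < s2 ->
  derivable (fun s : R => limit_val (s, k)) r 1 ->
  flow_map H (limit_val (r, k)) (derive1 (fun s : R => limit_val (s, k)) r).
Proof.
move=> D1 D2 rs df.
set f := fun s : R => limit_val (s, k) in df *.
apply: (osc_closed (hbc_flow_osc HBC)) => e e0.
have e20 : 0 < e / 2 by rewrite divr_gt0.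
have [d d0 dP] := limit_quotient e20 D1 D2 rs.
have cf := derivable_quotient_cvg df.
have [d' /= d'0 d'P] := cvgr_dist_le _ _ cf _ e20.
pose h := Num.min d d' / 2.
have m0 : 0 < Num.min d d' by rewrite lt_min d0.
have h0 : 0 < h by rewrite divr_gt0.
have [hd hd'] : h < d /\ h < d'.
  have : Num.min d d' <= d by rewrite ge_min lexx.
  have : Num.min d d' <= d' by rewrite ge_min lexx orbT.
  by rewrite /h; split; lra.
have [a Fa ha] := dP h h0 hd.
exists a => //.
have := d'P h; rewrite /ball_/= sub0r normrN gtr0_norm// gt_eqF// => /(_ hd' isT).
rewrite [h + r]addrC => hf.
rewrite -(subrK (h^-1 *: (f (r + h) - f r)) (derive1 f r)) -addrA.
apply: le_trans (ler_normD _ _) _.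
by move: ha; rewrite -/(f _) -/(f _) => ha; lra.
Qed.

Lemma limit_arc_solution : solution H limit_arc.
Proof.
split => /=.
- exact: (limit_init run FF Moo).
- move=> k s1 s2 s12 D.
  have D1 : limit_dom (s1, k) by apply: D; split => //=; rewrite in_itv/= lexx ltW.
  have D2 : limit_dom (s2, k) by apply: D; split => //=; rewrite in_itv/= lexx ltW.
  pose mu := @lebesgue_measure R.
  have ae_filter := @ae_filter_ringOfSetsType _ _ _ mu.
  have B10 : 0 < B + 1 by rewrite ltr_wpDl// (run_vbound_ge0 run).
  have ae1 : {ae mu, forall r, s1 < r < s2 ->
      derivable (fun s : R => limit_val (s, k)) r 1}.
    apply: (rv_lipschitz_ae_derivable B10) => a b s1a ab bs2.
    apply: le_trans (limit_lipschitz run FF Moo _ _ ab) _.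
    - by apply: (limit_dom_itv run FF Moo D1 D2); rewrite s1a (le_trans ab).
    - by apply: (limit_dom_itv run FF Moo D1 D2); rewrite bs2 (le_trans s1a).
    - by rewrite ler_wpM2r ?subr_ge0// lerDl.
  have ae2 (a : R) : {ae mu, forall r, r != a}.
    exists [set a]; split.
    - exact: measurable_set1.
    - exact: lebesgue_measure_set1.
    - by move=> r /= /negP; rewrite negbK => /eqP.
  apply: filterS3 ae1 (ae2 s1) (ae2 s2) => r dr r1 r2.
  rewrite /= in_itv/= => /andP[s1r rs2].
  have rs : s1 < r < s2.
    by rewrite !lt_neqAle s1r rs2 eq_sym r1 r2.
  have [Cp _] := limit_flow_set run FF Moo D1 D2 rs.
  split => //; first exact: dr.
  by apply: (limit_derivative D1 D2 rs); exact: dr.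
- by move=> s k; exact: (limit_jump run FF Moo).
Qed.

End LimitSolution.

(** * Invariance and chains in the omega-limit set of a run *)

Section RunOmega.
Variables (R : realType) (n : nat) (H : hybrid_inclusion R n).
Variables (x : nat -> 'rV[R]_n) (t : nat -> R) (c : nat -> nat).
Variables (g : nat -> 'rV[R]_n) (X B w : R).
Hypothesis HBC : hybrid_basic_conditions H.
Hypothesis run : asymptotic_run H x t c g X B w.

Notation hybrid_time := (hybrid_time t c).

Definition run_omega : set 'rV[R]_n :=
  [set z | forall e, 0 < e -> forall m0, exists2 m, (m0 <= m)%N & `|z - x m| <= e].

Lemma run_omega_filter (F : set_system nat) (FP : ProperFilter F) (N : nat -> nat) z :
  N @ F --> \oo -> x (N i) @[i --> F] --> z -> run_omega z.
Proof.
move=> Noo xz e e0 m0.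
have : \forall i \near F, (m0 <= N i)%N /\ `|z - x (N i)| <= e.
  near=> i; split; near: i; first exact: (cvgnyPge N).1 Noo m0.
  exact: cvgr_dist_le xz _ e0.
by move=> /filter_ex[i [h1 h2]]; exists (N i).
Unshelve. all: by end_near. Qed.

Lemma run_omega_seq z : run_omega z ->
  exists u : nat -> nat, u @ \oo --> \oo /\ x (u i) @[i --> \oo] --> z.
Proof.
move=> Oz.
have near_z (j : nat) : exists m, (j <= m)%N /\ `|z - x m| <= j.+1%:R^-1.
  by have [|m h1 h2] := Oz j.+1%:R^-1 _ j; [rewrite invr_gt0|exists m].
have [u uP] := choice near_z; exists u; split.
  apply/cvgnyPge => A; exists A => // j /= /leq_trans; apply.
  by case: (uP j).
apply/cvgrPdist_le => /= d d0.
apply: filterS (near_infty_natSinv_lt (PosNum d0)) => j /ltW jd.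
by case: (uP j) => _ /le_trans; apply.
Qed.

Lemma run_omega_nonempty : run_omega !=set0.
Proof.
have [U [UU Uoo]] := ultraFilterLemma eventually_filter.
have [z xz] := ultra_cvg_rV UU (run_bounded run).
by exists z; exact: (@run_omega_filter U _ id z Uoo xz).
Qed.

Lemma run_omega_compact : compact run_omega.
Proof.
apply: bounded_closed_compact.
  exists (X + 1); split; first exact: num_real.
  move=> a Xa z Oz; have [m _ zm] := Oz 1 ltr01 0%N.
  rewrite -(subrK (x m) z); apply: le_trans (ler_normD _ _) _.
  have := run_bounded run m; lra.
move=> z clz e e0 m0.
have e20 : 0 < e / 2 by rewrite divr_gt0.
have [y [Oy zy]] := clz _ (nbhsx_ballx z _ e20).
have [m m0m ym] := Oy _ e20 m0; exists m => //.
rewrite -(subrK y z) -addrA; apply: le_trans (ler_normD _ _) _.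
have : `|z - y| < e / 2 by rewrite -ball_normE in zy.
lra.
Qed.

(** The values of the limit arc are limits of the run at indices that are at least
    [M i], hence tend to infinity, and so belong to the omega-limit set. *)
Lemma limit_shadow (F : set_system nat) (FF : UltraFilter F) (M N : nat -> nat)
    (K : R) :
  M @ F --> \oo ->
  (\forall i \near F, (M i <= N i)%N /\
     hybrid_time (N i) - hybrid_time (M i) <= K) ->
  exists (xi : hybrid_arc R n) (s : R) (k : nat),
    [/\ solution H xi, arc_complete xi, xi @` arc_dom xi `<=` run_omega &
      [/\ arc_dom xi (s, k), x (M i) @[i --> F] --> xi (0, 0%N),
        x (N i) @[i --> F] --> xi (s, k) &
        hybrid_time (N i) - hybrid_time (M i) @[i --> F] --> s + k%:R]].
Proof.
move=> Moo NK.
have [k [s T]] := track_bounded run FF NK.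
exists (limit_arc run FF Moo), s, k; split.
- exact: limit_arc_solution.
- exact: limit_arc_complete.
- move=> _ [[s' k'] [N' T'] <-].
  exact: (@run_omega_filter F _ N' _ (track_oo FF Moo T') (limit_valP run FF Moo T')).
- split.
  + by exists N.
  + exact: (limit_valP run FF Moo (track_start t c FF M)).
  + exact: (limit_valP run FF Moo T).
  + case: T => Nk Ns.
    have h : t (N i) - t (M i) + k%:R @[i --> F] --> s + k%:R.
      by apply: cvgD => //; exact: cvg_cst.
    apply: cvg_trans h; apply: near_eq_cvg; apply: filterS Nk => i [_ h] /=.
    by rewrite /hybrid_time h natrD; ring.
Qed.

(** The pieces of the run end at the indices [u i] where it approaches [z], and start
    a hybrid time [T] earlier; the limit arc then passes through [z]. *)
Lemma run_omega_weakly_invariant : weakly_invariant H run_omega.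
Proof.
move=> z T Oz T0.
have [u [uoo uz]] := run_omega_seq Oz.
have [F [FF Foo]] := ultraFilterLemma eventually_filter.
have FP : ProperFilter F := @ultra_proper _ _ FF.
have uF : u @ F --> \oo by apply: cvg_trans uoo; exact: cvg_app.
have hu : hybrid_time (u i) @[i --> F] --> +oo.
  exact: cvg_comp uF (hybrid_time_pinfty run).
have [m0 _ m0P] := hybrid_time_step run.
have [M MP] : exists M : nat -> nat, \forall i \near F,
    [/\ (m0 <= M i < u i)%N, hybrid_time (M i) < hybrid_time (u i) - T &
      hybrid_time (u i) - T <= hybrid_time (M i).+1].
  apply: (@near_choice F _ (fun i m => [/\ (m0 <= m < u i)%N,
     hybrid_time m < hybrid_time (u i) - T &
     hybrid_time (u i) - T <= hybrid_time m.+1])).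
  near=> i.
  have um0 : (m0 <= u i)%N by near: i; exact: (cvgnyPge u).1 uF m0.
  have hm0 : hybrid_time m0 + T + 1 <= hybrid_time (u i).
    by near: i; exact: (cvgryPge (hybrid_time \o u)).1 hu _.
  have [|m h1 /andP[h2 h3]] := @crossing _ hybrid_time (hybrid_time (u i) - T) _ _ um0.
    by apply/andP; split; lra.
  by exists m.
have Moo : M @ F --> \oo.
  apply/cvgnyPge => A; near=> i.
  have [_ _ h] : [/\ (m0 <= M i < u i)%N, hybrid_time (M i) < hybrid_time (u i) - T &
      hybrid_time (u i) - T <= hybrid_time (M i).+1] by near: i.
  have hA : hybrid_time A + T + 1 <= hybrid_time (u i).
    by near: i; exact: (cvgryPge (hybrid_time \o u)).1 hu _.
  rewrite -ltnS ltnNge; apply/negP => /(hybrid_time_homo run); lra.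
have [|xi [s [k [sol cpl rng [Dsk _ xu hs]]]]] :=
    limit_shadow (N := u) (K := T + 1) FF Moo.
  apply: filterS MP => i [/andP[m0M /ltnW Mu] h1 h2]; split => //.
  by have := m0P (M i) m0M; lra.
exists xi; split => //; exists s, k; split => //.
  have uzF : x (u i) @[i --> F] --> z by apply: cvg_trans uz; exact: cvg_app.
  exact: (cvg_unique (@norm_hausdorff _ _) xu uzF).
apply: (cvgr_to_ge hs); apply: filterS MP => i [_ h1 _]; lra.
Unshelve. all: by end_near. Qed.

(** The error is measured in the maximum norm, not in the Euclidean one as in chain
    transitivity. *)
Definition link (T e : R) (a b : 'rV[R]_n) : Prop :=
  exists (xi : hybrid_arc R n) (s : R) (k : nat),
    [/\ solution H xi, xi @` arc_dom xi `<=` run_omega,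
      arc_dom xi (s, k) /\ T <= s + k%:R, xi (0, 0%N) = a &
      `|b - xi (s, k)| <= e].

(** If pieces starting arbitrarily late were not shadowed, a limit arc of these very
    pieces would shadow one of them. *)
Lemma shadowing (T K e : R) : 0 < e -> \forall m0 \near \oo, forall m m',
  (m0 <= m <= m')%N -> T <= hybrid_time m' - hybrid_time m <= K ->
  exists a, `|a - x m| <= e /\
    forall b, `|b - x m'| <= e -> link T (e + e) a b.
Proof.
move=> e0; apply: contrapT => nP.
have bad (j : nat) : exists mm : nat * nat, [/\ (j <= mm.1 <= mm.2)%N,
    T <= hybrid_time mm.2 - hybrid_time mm.1 <= K &
    forall a, `|a - x mm.1| <= e ->
      (forall b, `|b - x mm.2| <= e -> link T (e + e) a b) -> False].
  apply: contrapT => nm; apply: nP; exists j => // j' /= jj' m m' mm' hK.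
  apply: contrapT => na; apply: nm; exists (m, m'); split => //=.
    by case/andP: mm' => h1 ->; rewrite (leq_trans jj').
  by move=> a h1 h2; apply: na; exists a.
have [MN MNP] := choice bad.
have [F [FF Foo]] := ultraFilterLemma eventually_filter.
have FP : ProperFilter F := @ultra_proper _ _ FF.
have Moo : (fst \o MN) @ F --> \oo.
  apply/cvgnyPge => A; have : F [set j | (A <= j)%N] by apply: Foo; exists A.
  by apply: filterS => j /= /leq_trans; apply; case: (MNP j) => /andP[].
have [|xi [s [k [sol cpl rng [Dsk xM xN hs]]]]] :=
    limit_shadow (N := snd \o MN) (K := K) FF Moo.
  by apply: nearW => i /=; case: (MNP i) => /andP[_ ->] /andP[_ ->].
have /filter_ex[i [h1 h2]] : \forall i \near F,
    `|xi (0, 0%N) - x (MN i).1| <= e /\ `|xi (s, k) - x (MN i).2| <= e.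
  by near=> i; split; near: i; [exact: cvgr_dist_le xM _ e0|exact: cvgr_dist_le xN _ e0].
case: (MNP i) => _ _ /(_ _ h1); apply => b bx.
exists xi, s, k; split => //.
  split => //; apply: (cvgr_to_ge hs); apply: nearW => j.
  by case: (MNP j) => _ /andP[].
rewrite -(subrK (x (MN i).2) b) -addrA; apply: le_trans (ler_normD _ _) _.
by apply: lerD => //; rewrite distrC.
Unshelve. all: by end_near. Qed.

(** The pieces start at indices at which the run tends to [z], so that the limit arc
    starts at [z] itself. *)
Lemma shadowing_from (z : 'rV[R]_n) (T e : R) (m0 : nat) : run_omega z ->
  0 < T -> 0 < e -> exists2 m, (m0 <= m)%N &
    forall b, `|b - x m| <= e -> link T (e + e) z b.
Proof.
move=> Oz T0 e0.
have [u [uoo uz]] := run_omega_seq Oz.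
have [F [FF Foo]] := ultraFilterLemma eventually_filter.
have FP : ProperFilter F := @ultra_proper _ _ FF.
have uF : u @ F --> \oo by apply: cvg_trans uoo; exact: cvg_app.
have uzF : x (u i) @[i --> F] --> z by apply: cvg_trans uz; exact: cvg_app.
have [m1 _ m1P] := first_passage run.
have [N NP] : exists N : nat -> nat, \forall i \near F, (u i <= N i)%N /\
    hybrid_time (u i) + T <= hybrid_time (N i) <= hybrid_time (u i) + T + 1.
  apply: (@near_choice F _ (fun i m => (u i <= m)%N /\
    hybrid_time (u i) + T <= hybrid_time m <= hybrid_time (u i) + T + 1)).
  apply: filterS ((cvgnyPge u).1 uF m1) => i m1u.
  have [||m' h1 h2] := m1P m1 (leqnn _) (u i) (hybrid_time (u i) + T) => //.
    by rewrite lerDl ltW.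
  by exists m'.
have [|xi [s [k [sol cpl rng [Dsk xM xN hs]]]]] :=
    limit_shadow (N := N) (K := T + 1) FF uF.
  by apply: filterS NP => i [-> h]; split => //; lra.
have /filter_ex[i [h1 h2]] : \forall i \near F,
    (m0 <= N i)%N /\ `|xi (s, k) - x (N i)| <= e.
  near=> i; split; last by near: i; exact: cvgr_dist_le xN _ e0.
  apply: (@leq_trans (u i)); first by near: i; exact: (cvgnyPge u).1 uF m0.
  by near: i; apply: filterS NP => i [].
exists (N i) => // b bx; exists xi, s, k; split => //.
- split => //; apply: (cvgr_to_ge hs); apply: filterS NP => j [_ h]; lra.
- exact: (cvg_unique (@norm_hausdorff _ _) xM uzF).
rewrite -(subrK (x (N i)) b) -addrA; apply: le_trans (ler_normD _ _) _.
by apply: lerD => //; rewrite distrC.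
Unshelve. all: by end_near. Qed.

Definition chain (T e : R) (a b : 'rV[R]_n) : Prop :=
  exists (N : nat) (xs : nat -> 'rV[R]_n), [/\ (1 <= N)%N, xs 0%N = a, xs N = b &
    forall k, (k < N)%N -> link T e (xs k) (xs k.+1)].

Lemma chain1 T e a b : link T e a b -> chain T e a b.
Proof.
by move=> ab; exists 1%N, (fun k => if k is 0 then a else b); split => // -[].
Qed.

Lemma chain_cons T e a b d : link T e a b -> chain T e b d -> chain T e a d.
Proof.
move=> ab [N [xs [N1 x0 xN xl]]].
exists N.+1, (fun k => if k is k'.+1 then xs k' else a); split => //.
by move=> [_|k]; [rewrite x0|exact: xl].
Qed.

(** The piece of the run from [m] to [q] is cut into shadowed pieces of hybrid time
    between [T] and [2 * T + 1]; the induction is on its length in units of [T].  Only a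
    point near [x m] starts the chain, as the first shadowing arc need not start at a
    prescribed point. *)
Lemma chain_to (T e : R) (y : 'rV[R]_n) : 0 < T -> 0 < e ->
  \forall m0 \near \oo, forall m q, (m0 <= m)%N ->
    T <= hybrid_time q - hybrid_time m -> `|y - x q| <= e ->
    exists a, `|a - x m| <= e /\ chain T (e + e) a y.
Proof.
move=> T0 e0.
have [m1 _ m1P] := shadowing T (T + T + 1) e0.
have [m2 _ m2P] := first_passage run.
exists (maxn m1 m2) => // m0; rewrite /= geq_max => /andP[m10 m20].
suff h (D : nat) : forall m q, (m0 <= m)%N ->
    T <= hybrid_time q - hybrid_time m ->
    hybrid_time q - hybrid_time m <= D%:R * T -> `|y - x q| <= e ->
    exists a, `|a - x m| <= e /\ chain T (e + e) a y.
  move=> m q m0m Tq yq.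
  apply: (h (Num.bound ((hybrid_time q - hybrid_time m) / T)) m q) => //.
  rewrite -ler_pdivrMr// ltW// archi_boundP// divr_ge0 ?(ltW T0)//.
  exact: (le_trans (ltW T0) Tq).
elim: D => [|D IH] m q m0m Tq qD yq; first by lra.
have mq : (m <= q)%N.
  by rewrite leqNgt; apply/negP => /ltnW/(hybrid_time_homo run); lra.
have [le2|gt2] := leP (hybrid_time q - hybrid_time m) (T + T + 1).
  have [||a [am aq]] := m1P m0 m10 m q.
  - by rewrite m0m.
  - by rewrite Tq.
  by exists a; split => //; exact/chain1/aq.
have [||m' mm' /andP[h1 h2]] := m2P m0 m20 m (hybrid_time m + T) => //.
  by rewrite lerDl ltW.
have [||||a' [am' ch]] := IH m' q.
- exact: leq_trans mm'.
- by lra.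
- by move: qD; rewrite -addn1 natrD; lra.
- exact: yq.
have [||a [am aq]] := m1P m0 m10 m m'.
- by rewrite m0m.
- by apply/andP; split; lra.
by exists a; split => //; apply: chain_cons ch; exact: aq.
Qed.

Lemma run_omega_chain_transitive : internally_chain_transitive H run_omega.
Proof.
move=> z y T e Oz Oy T0 e0.
(* The end of an arc and the start of the next one are both within [e'] of the run,
   and the Euclidean norm is at most [n + 1] times the maximum norm. *)
pose e' := e / (2 * n.+1%:R).
have n0 : 0 < n.+1%:R :> R by rewrite ltr0n.
have e'0 : 0 < e' by rewrite divr_gt0// mulr_gt0.
have [m0 _ m0P] := chain_to y T0 e'0.
have [m m0m zm] := shadowing_from m0 Oz T0 e'0.
have [q0 _ q0P] := (cvgryPge _).1 (hybrid_time_pinfty run) (hybrid_time m + T).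
have [q q0q yq] := Oy _ e'0 q0.
have [|a [am ch]] := m0P m0 (leqnn _) m q m0m _ yq.
  by have := q0P q q0q; rewrite /=; lra.
have [N [xs [N1 xs0 xsN xl]]] := chain_cons (zm _ am) ch.
have /choice[f fP] : forall k, exists f : hybrid_arc R n * (R * nat), (k < N)%N ->
    [/\ solution H f.1, f.1 @` arc_dom f.1 `<=` run_omega,
      arc_dom f.1 f.2 /\ T <= f.2.1 + f.2.2%:R, f.1 (0, 0%N) = xs k &
      `|xs k.+1 - f.1 f.2| <= e' + e'].
  move=> k; have [kN|_] := ltnP k N; last first.
    by case: (xl 0%N N1) => xi _; exists (xi, (0, 0%N)).
  by have [xi [s [i h]]] := xl k kN; exists (xi, (s, i)).
exists N, xs, (fun k => (f k).1), (fun k => (f k).2.1), (fun k => (f k).2.2).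
split => // k kN; have [sol rng [D hT] f0 fe] := fP k kN.
rewrite -surjective_pairing; split => //.
- apply: le_trans (enorm_le_norm _) _.
  have -> : e = n.+1%:R * (e' + e') by rewrite /e'; field; rewrite gt_eqF.
  by rewrite ler_pM2l.
- by move=> s i Dsi _; apply: rng; exists (s, i).
Qed.

End RunOmega.

(** * Enumeration of hybrid sequence domains *)

Section NatExtrema.

Lemma nat_minE (A : set nat) a : A a -> (forall b, A b -> (a <= b)%N) ->
  nat_min A = a.
Proof.
move=> Aa aA.
have [Am mA] : (A `&` lbound A) (nat_min A).
  by apply: (xgetPex 0%N); exists a; split => // b /aA; rewrite leEnat.
by apply/eqP; rewrite eqn_leq aA// andbT -leEnat; exact: mA.
Qed.

Lemma nat_maxP (A : set nat) a K : A a -> (forall b, A b -> (b <= K)%N) ->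
  forall b, A b -> (b <= nat_max A)%N.
Proof.
move=> Aa AK b Ab.
have exA : exists i, `[< A i >] by exists a; apply/asboolP.
have bdA i : `[< A i >] -> (i <= K)%N by move/asboolP/AK.
have [_ mA] : (A `&` ubound A) (nat_max A).
  apply: (xgetPex 0%N); case: (ex_maxnP exA bdA) => i /asboolP Ai iP.
  by exists i; split => // j /asboolP/iP; rewrite leEnat.
by rewrite -leEnat; exact: mA.
Qed.

Lemma cluster_of_filter (T : topologicalType) (u : nat -> T)
    (F : set_system nat) (FP : ProperFilter F) (N : nat -> nat) p :
  N @ F --> \oo -> u (N i) @[i --> F] --> p -> cluster (u @ \oo) p.
Proof.
move=> Noo up A B uA Bp.
have FA : F [set i | A (u (N i))] by exact: Noo uA.
have FB : F [set i | B (u (N i))] by exact: up Bp.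
by have [i [Ai Bi]] := filter_ex (filterI FA FB); exists (u (N i)).
Qed.

Variable a : nat -> nat.
Hypothesis aS : forall m, a m.+1 = a m \/ a m.+1 = (a m).+1.

Lemma slow_homo : {homo a : i j / (i <= j)%N >-> (i <= j)%N}.
Proof.
apply: homo_leq => [//|i j k /leq_trans|i]; first exact.
by case: (aS i) => ->.
Qed.

(** If [a] still increases after it has reached [K], it reaches [K + 1]; otherwise it
    is stationary. *)
Lemma slow_grows_or_stops K :
  \forall m \near \oo, (K <= a m)%N \/ a m.+1 = a m.
Proof.
elim: K => [|K [m0 _ m0P]]; first by exists 0%N => // m _; left.
have [[m [m0m am]]|nm] := pselect (exists m, (m0 <= m)%N /\ a m.+1 = (a m).+1).
  exists m.+1 => // m' /= mm'; left; apply: leq_trans (slow_homo mm').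
  by rewrite am ltnS; case: (m0P m m0m) => //; rewrite am => /eqP; rewrite gtn_eqF.
exists m0 => // m m0m; right; case: (aS m) => // am.
by exfalso; apply: nm; exists m.
Qed.

Lemma slow_pinfty (F : set_system nat) : Filter F -> F --> \oo ->
  (\forall m \near F, a m.+1 = (a m).+1) -> a @ F --> \oo.
Proof.
move=> FF Foo aF; apply/cvgnyPge => K.
apply: filterS2 aF (Foo _ (slow_grows_or_stops K)) => m am [//|].
by rewrite am => /eqP; rewrite gtn_eqF.
Qed.

End NatExtrema.

Section SequenceDomain.
Variable E : set (nat * nat).
Hypothesis domE : hybrid_sequence_domain E.

Lemma compact_sequence_domain_comparable D p q :
  compact_hybrid_sequence_domain D -> D p -> D q ->
  (p.1 <= q.1 /\ p.2 <= q.2)%N \/ (q.1 <= p.1 /\ q.2 <= p.2)%N.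
Proof.
move=> [J [k [_ _ kS ->]]] [i /= iJ [/= ip pi]] [j /= jJ [/= jq qj]].
have kle a b : (a <= b)%N -> (b <= J)%N -> (k a <= k b)%N.
  elim: b => [|b IH]; first by rewrite leqn0 => /eqP ->.
  rewrite leq_eqVlt ltnS => /predU1P[-> //|ab bJ].
  exact: leq_trans (IH ab (ltnW bJ)) (kS b bJ).
move: ip jq => /andP[ip1 ip2] /andP[jq1 jq2]; rewrite pi qj.
have [ij|ji|ij] := ltngtP i j.
- by left; split => //; apply: leq_trans ip2 (leq_trans (kle _ _ ij (ltnW jJ)) jq1).
- by right; split => //; apply: leq_trans jq2 (leq_trans (kle _ _ ji (ltnW iJ)) ip1).
- by case/orP: (leq_total p.1 q.1); [left|right].
Qed.

Lemma sequence_domain_comparable p q : E p -> E q ->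
  (p.1 <= q.1 /\ p.2 <= q.2)%N \/ (q.1 <= p.1 /\ q.2 <= p.2)%N.
Proof.
have [U [cU Und] ->] := domE => -[i _ Uip] [j _ Ujq].
have Ule a b : (a <= b)%N -> U a `<=` U b.
  elim: b => [|b IH]; first by rewrite leqn0 => /eqP ->.
  rewrite leq_eqVlt ltnS => /predU1P[-> //|ab].
  exact: subset_trans (IH ab) (Und b).
apply: (compact_sequence_domain_comparable (cU (maxn i j))).
  by apply: Ule Uip; rewrite leq_maxl.
by apply: Ule Ujq; rewrite leq_maxr.
Qed.

Lemma sequence_domain_pred p : E p -> (0 < p.1 + p.2)%N ->
  exists2 q, E q & p = (q.1.+1, q.2) \/ p = (q.1, q.2.+1).
Proof.
have [U [cU _] ->] := domE => -[i _ Uip] p0.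
have [J [k [J1 k0 kS UE]]] := cU i.
suff [q Uq pq] : exists2 q, U i q & p = (q.1.+1, q.2) \/ p = (q.1, q.2.+1).
  by exists q => //; exists i.
move: Uip p0; rewrite UE => -[l /= lJ]; case: p => p1 p2 [/= /andP[h1 h2] ->] p0.
have [klp|pkl] := ltnP (k l) p1.
  exists (p1.-1, l); last by left; rewrite /= prednK// (leq_trans _ klp).
  by exists l => //=; split => //=; lia.
have {pkl h1}p1E : p1 = k l by apply/eqP; rewrite eqn_leq pkl h1.
case: l => [|l] in lJ h2 p0 p1E *; first by move: p0; rewrite p1E k0.
exists (p1, l); last by right.
exists l => /=; first exact: ltnW.
by split => //=; rewrite p1E leqnn kS// ltnW.
Qed.

Hypothesis Eoo : ~ has_ubound [set (p.1 + p.2)%N | p in E].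

(** Comparability leaves at most one point on each antidiagonal; walking back from a
    far point of the unbounded domain along predecessors meets all antidiagonals before
    it. *)
Lemma sequence_domain_enum : exists p : nat -> nat * nat,
  [/\ forall m, E (p m), forall m, ((p m).1 + (p m).2)%N = m,
    forall q, E q -> q = p (q.1 + q.2)%N &
    forall m, p m.+1 = ((p m).1.+1, (p m).2) \/ p m.+1 = ((p m).1, (p m).2.+1)].
Proof.
have ex m : exists q, E q /\ (q.1 + q.2)%N = m.
  have [q0 Eq0 mq0] : exists2 q, E q & (m <= q.1 + q.2)%N.
    apply: contrapT => nq; apply: Eoo; exists m => _ [q Eq <-].
    by rewrite leEnat leqNgt; apply/negP => mq; apply: nq; exists q => //; exact: ltnW.
  have : (q0.1 + q0.2 = m + (q0.1 + q0.2 - m))%N by rewrite subnKC.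
  move: (_ - m)%N => d; elim: d q0 Eq0 {mq0} => [|d IH] q Eq qd.
    by exists q; rewrite qd addn0.
  have [|q' Eq' qq'] := sequence_domain_pred Eq; first by rewrite qd addnS.
  by apply: IH Eq' _; case: qq' qd => -> /=; lia.
have [p pP] := choice ex.
have Ep m : E (p m) by case: (pP m).
have sp m : ((p m).1 + (p m).2)%N = m by case: (pP m).
have pU q : E q -> q = p (q.1 + q.2)%N.
  move=> Eq; have := sp (q.1 + q.2)%N.
  have := sequence_domain_comparable Eq (Ep (q.1 + q.2)%N).
  by case: q {Eq} (p _) => q1 q2 [p1 p2] /= h1 h2; congr pair; lia.
exists p; split => // m.
have [|q Eq pq] := sequence_domain_pred (Ep m.+1); first by rewrite sp.
have qE : q = p m.
  rewrite [LHS](pU _ Eq); congr p.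
  by have := sp m.+1; case: pq => -> /=; lia.
by rewrite -qE.
Qed.

End SequenceDomain.

(** * Asymptotic simulations are runs *)

Section SimulationRun.
Variables (R : realType) (n : nat) (H : hybrid_inclusion R n).
Variables (phi : hybrid_sequence R n) (h : nat -> R).
Hypothesis sim : asymptotic_simulation H phi h.
Variable p : nat -> nat * nat.
Hypothesis pE : forall m, seq_dom phi (p m).
Hypothesis p_sum : forall m, ((p m).1 + (p m).2)%N = m.
Hypothesis p_surj : forall q, seq_dom phi q -> q = p (q.1 + q.2)%N.
Hypothesis p_step : forall m,
  p m.+1 = ((p m).1.+1, (p m).2) \/ p m.+1 = ((p m).1, (p m).2.+1).

Let k m := (p m).1.
Let c m := (p m).2.
Let x m := phi (p m).
Let t m := tau h (k m).

Let kS m : k m.+1 = k m \/ k m.+1 = (k m).+1.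
Proof. by rewrite /k; case: (p_step m) => ->; [right|left]. Qed.

Let cS m : c m.+1 = c m \/ c m.+1 = (c m).+1.
Proof. by rewrite /c; case: (p_step m) => ->; [left|right]. Qed.

Let kc m : (k m.+1 = k m <-> c m.+1 = (c m).+1) /\
  (c m.+1 = c m <-> k m.+1 = (k m).+1).
Proof.
by have := p_sum m; have := p_sum m.+1; rewrite -/(k _) -/(c _) -/(k _) -/(c _);
  case: (kS m); case: (cS m); lia.
Qed.

Lemma tauS i : tau h i.+1 = tau h i + h i.+1.
Proof. by rewrite /tau big_nat_recr. Qed.

Lemma step_gt0 i : 0 < h i.+1.
Proof. by have [h0 _ _] := sim_steps sim; exact: h0. Qed.

(** A flow step is the only step of the run between two given first coordinates, so
    that no point of [seq_dom phi] with the next first coordinate has a lower level. *)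
Lemma jbar_enum m : c m.+1 = c m -> jbar phi (k m) = c m.
Proof.
move=> cm; have km := (kc m).2.1 cm.
apply: nat_minE => [|j /= Ej].
  by rewrite /= -km -cm /k /c -surjective_pairing.
rewrite leqNgt; apply/negP => jc.
have jm : ((k m).+1 + j <= m)%N.
  by rewrite addSnnS -[leqRHS](p_sum m) leq_add2l.
have := slow_homo kS jm; rewrite {1}/k -(p_surj Ej) /= ltnn; exact: notF.
Qed.

Lemma kbar_enum m : c m.+1 = (c m).+1 -> kbar phi (c m) = k m.
Proof.
move=> cm; have km := (kc m).1.2 cm.
apply: nat_minE => [|i /= Ei].
  by rewrite /= -km -cm /k /c -surjective_pairing.
rewrite leqNgt; apply/negP => ik.
have im : (i + (c m).+1 <= m)%N.
  by rewrite -addSnnS -[leqRHS](p_sum m) leq_add2r.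
have := slow_homo cS im; rewrite {1}/c -(p_surj Ei) /= ltnn; exact: notF.
Qed.

Lemma tau_homo : {homo tau h : i j / (i <= j)%N >-> i <= j}.
Proof.
apply: homo_leq => [//|i|i]; first exact: le_trans.
by rewrite tauS lerDl ltW// step_gt0.
Qed.

Lemma simulation_step m :
  (c m.+1 = c m /\ t m <= t m.+1) \/ (c m.+1 = (c m).+1 /\ t m.+1 = t m).
Proof.
case: (cS m) => cm; [left|right]; split => //.
  by rewrite /t ((kc m).2.1 cm); apply: tau_homo.
by rewrite /t ((kc m).1.2 cm).
Qed.

Lemma simulation_mesh : (fun m => t m.+1 - t m) @ \oo --> (0 : R).
Proof.
have [_ h0 _] := sim_steps sim.
apply/cvgr0Pnorm_le => e e0.
have [K _ KP] := (cvgr0Pnorm_le _).1 h0 e e0.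
apply: filterS (slow_grows_or_stops kS K) => m; rewrite /t.
case: (kS m) => -> => [_|]; first by rewrite subrr normr0 ltW.
case=> [Kk|/eqP]; last by rewrite gtn_eqF.
by rewrite tauS addrAC subrr add0r; apply: KP => /=; exact: leqW.
Qed.

Lemma simulation_diverges a : exists m, a <= t m + (c m)%:R.
Proof.
have [_ _ hoo] := sim_steps sim.
have [K _ KP] := (cvgryPge _).1 hoo a.
have tau0 i : 0 <= tau h i by apply: le_trans (tau_homo (leq0n i)); rewrite /tau big_nil.
pose b := Num.bound (Num.max a 0).
exists (K + b)%N; have [Kk|kK] := leqP K (k (K + b)).
  by apply: le_trans (KP _ Kk) _; rewrite lerDl.
have cb : (b <= c (K + b))%N.
  by move: kK; have := p_sum (K + b)%N; rewrite -/(k _) -/(c _); lia.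
apply: (@le_trans _ _ (c (K + b)%N)%:R); last by rewrite lerDr tau0.
apply: (@le_trans _ _ b%:R); last by rewrite ler_nat.
apply: (@le_trans _ _ (Num.max a 0)); first by rewrite le_max lexx.
by rewrite ltW// archi_boundP// le_max lexx orbT.
Qed.

Lemma simulation_bounded : exists X, forall m, `|x m| <= X.
Proof.
have [X [_ XP]] := sim_bounded sim.
by exists (X + 1) => m; apply: (XP (X + 1)); [rewrite ltrDl|exists (p m)].
Qed.

Lemma simulation_jump (F : set_system nat) (a b : 'rV[R]_n) :
  ProperFilter F -> F --> \oo -> (\forall m \near F, c m.+1 = (c m).+1) ->
  x @ F --> a -> x m.+1 @[m --> F] --> b -> jump_set H a /\ jump_map H a b.
Proof.
move=> FP Foo cF xa xb.
have coo : c @ F --> \oo by exact: slow_pinfty Foo cF.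
have sj : seq_complete_j phi.
  move=> [K KP].
  have cK : \forall m \near F, (K < c m)%N by exact: (cvgnyPge c).1 coo K.+1.
  have [m Km] := filter_ex cK.
  have : (c m <= K)%O by apply: KP; exists (p m).
  by rewrite leEnat leqNgt Km.
pose u j := (phi (kbar phi j, j), phi (kbar phi j, j.+1)).
have uab : u (c m) @[m --> F] --> (a, b).
  have xx : (x m, x m.+1) @[m --> F] --> (a, b).
    exact: (@cvg_pair _ _ _ F (nbhs a) (nbhs b) _ _ _ x (fun m => x m.+1) xa xb).
  apply: cvg_trans xx; apply: near_eq_cvg; apply: filterS cF => m cm.
  rewrite /u kbar_enum// /x; congr (_ , _); congr (phi _).
    by rewrite /k /c -surjective_pairing.
  by rewrite -cm -((kc m).1.2 cm) /k /c -surjective_pairing.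
by have [Gab [Da _]] := sim_jump sim sj (cluster_of_filter _ coo uab).
Qed.

Section Flow.
Variables (f : nat -> 'rV[R]_n) (T : R).
Hypothesis fB : bounded_set (range f).
Hypothesis f_cluster : cluster ((fun k => (phi (k, jbar phi k), f k)) @ \oo)
            `<=` graph (flow_map H) `&` (flow_set H `*` setT).
Hypothesis T0 : 0 < T.
Hypothesis f_err : averaged_error phi h f T @ \oo --> (0 : R).

(** The supremum defining the averaged error is over a bounded set of indices, as
    [tau h] tends to infinity, so that it is an upper bound. *)
Lemma flow_drift_le (i l : nat) : (i < l)%N -> tau h l <= tau h i + T ->
  `|\sum_(i <= j < l) h j.+1 *: (discrete_velocity phi h j - f j)|
    <= averaged_error phi h f T i.
Proof.
move=> il lT; apply: le_trans (norm_le_enorm _) _.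
have [_ _ hoo] := sim_steps sim.
have [K _ KP] := (cvgryPgt _).1 hoo (tau h i + T).
have tauK j : tau h j <= tau h i + T -> (j <= K)%N.
  by move=> jT; rewrite leqNgt; apply/negP => /ltnW/KP; rewrite /= ltNge jT.
have lS : (l <= steps_until h (tau h i + T))%N.
  by apply: (@nat_maxP _ l K).
pose S := steps_until h (tau h i + T).
pose v l := enorm (\sum_(i <= j < l) h j.+1 *: (discrete_velocity phi h j - f j)).
apply: sup_upper_bound; last by exists l => //=; rewrite il.
split; first by exists (v l); exists l => //=; rewrite il.
exists (\sum_(j < S.+1) v j) => _ [j /= /andP[_ jS] <-].
have jS' : (j < S.+1)%N by [].
rewrite (bigD1 (Ordinal jS'))//= lerDl; apply: sumr_ge0 => a _.
exact: sqrtr_ge0.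
Qed.

(** Between jumps the increments of the run are those of the discrete velocity, as
    [jbar] gives the current level at flow steps. *)
Lemma flow_sum m d : c (m + d) = c m ->
  x (m + d) - x m - \sum_(m <= i < m + d) (t i.+1 - t i) *: f (k i) =
  \sum_(k m <= i < k m + d) h i.+1 *: (discrete_velocity phi h i - f i).
Proof.
elim: d => [|d IH] cd.
  by rewrite !addn0 !big_geq// !subrr.
have cmd : c (m + d) = c m.
  apply/eqP; rewrite eqn_leq -{1}cd (slow_homo cS)// ?(slow_homo cS) ?leq_addr//.
  by rewrite leq_add2l.
have cS' : c (m + d).+1 = c (m + d) by rewrite -addnS cd.
have kmd : k (m + d) = (k m + d)%N.
  by have := p_sum (m + d)%N; have := p_sum m; rewrite -/(k _) -/(c _) -/(k _) -/(c _); lia.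
have kS' := (kc _).2.1 cS'.
rewrite !addnS !big_nat_recr ?leq_addr//= -IH//.
have hne : h (k m + d).+1 != 0 by rewrite gt_eqF// step_gt0.
have -> : t (m + d).+1 - t (m + d)%N = h (k m + d).+1.
  by rewrite /t kS' kmd tauS addrAC subrr add0r.
rewrite kmd scalerBr /discrete_velocity scalerA divff// scale1r.
rewrite -kmd jbar_enum// -kS' -{1}cS' /k /c -!surjective_pairing -/(x _) -/(x _).
have -> : x (m + d).+1 - x m = (x (m + d) - x m) + (x (m + d).+1 - x (m + d)).
  by rewrite [RHS]addrC addrA subrK.
by rewrite opprD addrACA.
Qed.

(** Two indices on the same level are separated by flow steps only; if such steps
    occur arbitrarily late, the first coordinate is large at them. *)
Lemma flow_drift e : 0 < e -> \forall m0 \near \oo, forall m m',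
  (m0 <= m <= m')%N -> c m = c m' -> t m' <= t m + T ->
  `|x m' - x m - \sum_(m <= i < m') (t i.+1 - t i) *: f (k i)| <= e.
Proof.
move=> e0.
have [K _ KP] := (cvgr0Pnorm_le _).1 f_err e e0.
have [m1 _ m1P] := slow_grows_or_stops kS K.
exists m1 => // m0 /= m10 m m' /andP[m0m mm'] cc tT.
move: mm'; rewrite leq_eqVlt => /predU1P[<-|mm'].
  by rewrite big_geq// !subrr normr0 ltW.
have cmS : c m.+1 = c m.
  by apply/eqP; rewrite eqn_leq {1}cc !(slow_homo cS).
have Kk : (K <= k m)%N.
  case: (m1P m (leq_trans m10 m0m)) => // /eqP.
  by rewrite ((kc m).2.1 cmS) gtn_eqF.
have km' : k m' = (k m + (m' - m))%N.
  have := p_sum m'; have := p_sum m; move: mm'.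
  by rewrite -/(k _) -/(c _) -/(k _) -/(c _); lia.
have m'E : m' = (m + (m' - m))%N by rewrite subnKC// ltnW.
rewrite [in X in `|X|]m'E flow_sum -?m'E//.
have := flow_drift_le (i := k m) (l := k m').
rewrite /t in tT; rewrite km' in tT *.
move=> /(_ _ tT)/le_trans; apply.
  by rewrite -[ltnLHS]addn0 ltn_add2l subn_gt0.
by apply: le_trans (ler_norm _) _; exact: KP.
Qed.

Lemma flow_cluster (F : set_system nat) (a v : 'rV[R]_n) :
  ProperFilter F -> F --> \oo -> (\forall m \near F, c m.+1 = c m) ->
  x @ F --> a -> f (k m) @[m --> F] --> v -> flow_set H a /\ flow_map H a v.
Proof.
move=> FP Foo cF xa fv.
have koo : k @ F --> \oo.
  apply: slow_pinfty Foo _ => //.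
  by apply: filterS cF => m /(kc m).2.1.
pose u j := (phi (j, jbar phi j), f j).
have uav : u (k m) @[m --> F] --> (a, v).
  have xx : (x m, f (k m)) @[m --> F] --> (a, v).
    exact: (@cvg_pair _ _ _ F (nbhs a) (nbhs v) _ _ _ x (fun m => f (k m)) xa fv).
  apply: cvg_trans xx; apply: near_eq_cvg; apply: filterS cF => m cm.
  by rewrite /u jbar_enum// /x /k /c -surjective_pairing.
by have [Fav [Ca _]] := f_cluster (cluster_of_filter _ koo uav).
Qed.

End Flow.

(** When the sequence is not complete in the [k] direction the run eventually only
    jumps: no velocity is given, any will do, and the conditions on flows are void. *)
Lemma simulation_run : exists (g : nat -> 'rV[R]_n) (X B w : R),
  asymptotic_run H x t c g X B w.
Proof.
have [X XP] := simulation_bounded.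
have [kcomp|nkcomp] := pselect (seq_complete_k phi).
  have [f [fB fcl [T T0 fT]]] := sim_flow sim kcomp.
  have [B [_ BP]] := fB.
  exists (fun m => f (k m)), X, (B + 1), T; split => //.
  - exact: simulation_step.
  - exact: simulation_mesh.
  - exact: simulation_diverges.
  - by move=> m; apply: (BP (B + 1)); [rewrite ltrDl|exists (k m)].
  - exact: flow_drift.
  - exact: flow_cluster.
  - exact: simulation_jump.
have [K KP] : has_ubound (fst @` seq_dom phi) by exact: contrapT.
have kK m : (k m <= K)%N by rewrite -leEnat; apply: KP; exists (p m).
exists (fun=> 0), X, 0, 1; split => //.
- exact: simulation_step.
- exact: simulation_mesh.
- exact: simulation_diverges.
- by move=> m; rewrite normr0.
- move=> e e0; have [m1 _ m1P] := slow_grows_or_stops kS K.+1.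
  exists m1 => // m0 /= m10 m m' /andP[m0m mm'] cc _.
  move: mm'; rewrite leq_eqVlt => /predU1P[<-|mm'].
    by rewrite big_geq// !subrr normr0 ltW.
  have cmS : c m.+1 = c m.
    by apply/eqP; rewrite eqn_leq {1}cc !(slow_homo cS).
  case: (m1P m (leq_trans m10 m0m)); first by rewrite ltnNge kK.
  by rewrite ((kc m).2.1 cmS) => /eqP; rewrite gtn_eqF.
- move=> F a v FP Foo cF _ _.
  have koo : k @ F --> \oo.
    apply: slow_pinfty Foo _ => //.
    by apply: filterS cF => m /(kc m).2.1.
  have kF : \forall m \near F, (K < k m)%N by exact: (cvgnyPge k).1 koo K.+1.
  by have [m] := filter_ex kF; rewrite ltnNge kK.
- exact: simulation_jump.
Qed.

Lemma omega_limit_run : omega_limit phi = run_omega x.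
Proof.
apply/seteqP; split => z.
  move=> [u [uE uoo uz]] e e0 m0.
  have : \forall i \near \oo, (m0 <= (u i).1 + (u i).2)%N /\ `|z - phi (u i)| <= e.
    near=> i; split; near: i; last exact: cvgr_dist_le uz _ e0.
    exact: (cvgnyPge (fun i => ((u i).1 + (u i).2)%N)).1 uoo m0.
  move=> /filter_ex[i [h1 h2]]; exists ((u i).1 + (u i).2)%N => //.
  by rewrite /x -(p_surj (uE i)).
move=> /run_omega_seq[u [uoo uz]].
exists (fun i => p (u i)); split => //.
by under eq_fun do rewrite p_sum.
Unshelve. all: by end_near. Qed.

End SimulationRun.

(** * The limit set theorem *)

Theorem theorem5p1 (R : realType) (n : nat) (H : hybrid_inclusion R n)
    (phi : hybrid_sequence R n) (h : nat -> R) :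
  hybrid_basic_conditions H ->
  asymptotic_simulation H phi h ->
  [/\ omega_limit phi !=set0,
      compact (omega_limit phi),
      weakly_invariant H (omega_limit phi) &
      internally_chain_transitive H (omega_limit phi)].
Proof.
move=> HBC sim.
have [p [pE p_sum p_surj p_step]] :=
  sequence_domain_enum (seq_domP phi) (sim_complete sim).
have [g [X [B [w run]]]] := simulation_run sim pE p_sum p_surj p_step.
rewrite (omega_limit_run pE p_sum p_surj); split.
- exact: run_omega_nonempty run.
- exact: run_omega_compact run.
- exact: run_omega_weakly_invariant HBC run.
- exact: run_omega_chain_transitive HBC run.
Qed.
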